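(* Let $\mathcal H$ be a separable complex Hilbert space. The function $(C,A)\mapsto W_{\mathcal O(C)}(A)$ from $\mathcal L_1\times B(\mathcal H)$, equipped with the norm $\|(C,A)\|=\|C\|_1+\|A\|$, to bounded subsets of $\mathbb C$, equipped with the Hausdorff pseudometric $d_H$, is continuous. In fact, the function is Lipschitz in each variable separately with Lipschitz constant the norm (or trace norm) of the fixed operator. That is, for all $C,C'\in\mathcal L_1$ and $A,A'\in B(\mathcal H)$, $$d_H\big(W_{\mathcal O(C)}(A),W_{\mathcal O(C')}(A)\big)\le\|C-C'\|_1\,\|A\|$$ and $$d_H\big(W_{\mathcal O(C)}(A),W_{\mathcal O(C)}(A')\big)\le\|C\|_1\,\|A-A'\|.$$
   Context: $\mathcal L_1$ is the space of trace-class operators on $\mathcal H$ with trace norm $\|\cdot\|_1$; $\|\cdot\|$ is the operator norm. For $C\in\mathcal L_1$, $\mathcal U(C)=\{UCU^*:U\text{ unitary}\}$, $\mathcal O(C)$ is the trace-norm closure of $\mathcal U(C)$, and $W_{\mathcal O(C)}(A)=\{\operatorname{Tr}(XA):X\in\mathcal O(C)\}$. For bounded sets $Y,Z\subseteq\mathbb C$, $d_H(Y,Z)=\max\{\sup_{y\in Y}d(y,Z),\ \sup_{z\in Z}d(z,Y)\}$. *)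

(* Defs.v *)
From HB Require Import structures.
From mathcomp Require Import all_boot all_order all_algebra.
From mathcomp Require Import sesquilinear complex.
From mathcomp Require Import all_classical all_reals all_analysis.

Set Implicit Arguments.
Unset Strict Implicit.
Unset Printing Implicit Defensive.

Import Order.TTheory GRing.Theory Num.Theory.
Import numFieldNormedType.Exports.

Local Open Scope classical_set_scope.
Local Open Scope ring_scope.
Local Open Scope complex_scope.

(* Complex Hilbert spaces: complete normed spaces over R[i] whose norm comes
   from an inner product, which is linear in its first argument. *)
HB.mixin Record isHilbert (R : realType) H & CompleteNormedModule R[i] H := {
  inner : {dot H for (@Num.conj R[i])} ;
  inner_norm : forall x : H, inner x x = `|x| ^+ 2
}.

#[short(type="hilbertType")]
HB.structure Definition Hilbert (R : realType) :=
  {H of isHilbert R H & CompleteNormedModule R[i] H}.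

Definition separable (T : topologicalType) : Prop :=
  exists2 D : set T, countable D & dense D.

(* In a normed space over R[i] the norm takes values in R[i]; this is the same
   norm, seen in R. *)
Definition rnorm (R : realType) (V : normedModType R[i]) (x : V) : R :=
  complex.Re `|x|.

Section operators.
Context {R : realType} {H : hilbertType R}.
Implicit Types (A B C P U X Y : H -> H).

Definition opnorm A : \bar R :=
  ereal_sup [set (rnorm (A x))%:E | x in [set x : H | `|x| <= 1]].

Definition bounded_op A : Prop := linear A /\ (opnorm A < +oo)%E.

(* The adjoint exists and is unique for every bounded operator; the default
   value is only used for unbounded maps. *)
Definition adjoint A : H -> H :=
  xget (fun=> 0)
    [set B | bounded_op B /\ forall x y, inner (A x) y = inner x (B y)].

Definition unitary U : Prop :=
  [/\ bounded_op U, adjoint U \o U = id & U \o adjoint U = id].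

(* The order of R[i] is such that 0 <= z means that z is real and
   nonnegative. *)
Definition positive_op P : Prop :=
  bounded_op P /\ forall x, 0 <= inner (P x) x.

(* |C|, the positive square root of C^* C. *)
Definition abs_op C : H -> H :=
  xget (fun=> 0) [set P | positive_op P /\ P \o P = adjoint C \o C].

(* Some vectors may be null, so that orthonormal bases of finite-dimensional
   spaces are covered as well: the nonnull vectors of the sequence form a
   maximal orthonormal set, and the null ones do not contribute to the sums
   below. *)
Definition orthonormal_basis (e : nat -> H) : Prop :=
  [/\ forall i j, i != j -> inner (e i) (e j) = 0,
      forall i, e i = 0 \/ `|e i| = 1 &
      forall x, (forall i, inner x (e i) = 0) -> x = 0].

(* Some orthonormal basis of H, if H is separable. The trace norm, and the
   trace of a trace-class operator, do not depend on the basis. *)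
Definition hilbert_basis : nat -> H :=
  xget (fun=> 0) [set e | orthonormal_basis e].

(* Tr |C|, which is +oo if C is bounded but not trace-class. *)
Definition trace_norm C : \bar R :=
  (\sum_(0 <= n <oo)
    (complex.Re (inner (abs_op C (hilbert_basis n)) (hilbert_basis n)))%:E)%E.

Definition trace_class C : Prop := bounded_op C /\ (trace_norm C < +oo)%E.

(* R[i]^o is R[i] as a normed space over itself. *)
Definition trace X : R[i]^o :=
  limn (fun n =>
    \sum_(k < n) inner (X (hilbert_basis k)) (hilbert_basis k) : R[i]^o).

Definition unitary_orbit C : set (H -> H) :=
  [set U \o C \o adjoint U | U in unitary].

Definition closed_orbit C : set (H -> H) :=
  [set X | trace_class X /\
    forall eps : R, 0 < eps ->
      exists2 Y, unitary_orbit C Y & (trace_norm (X \- Y)%R < eps%:E)%E].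

Definition orbit_range C A : set R[i]^o :=
  [set trace (X \o A) | X in closed_orbit C].

End operators.

Section hausdorff.
Context {R : realType} {V : normedModType R[i]}.

Definition dist_set (y : V) (Z : set V) : \bar R :=
  ereal_inf [set (rnorm (y - z))%:E | z in Z].

Definition hausdorff_dist (Y Z : set V) : \bar R :=
  maxe (ereal_sup [set dist_set y Z | y in Y])
       (ereal_sup [set dist_set z Y | z in Z]).

End hausdorff.

(* Main.v *)
Require Import Defs.
From mathcomp Require Import all_boot all_order all_algebra.
From mathcomp Require Import sesquilinear complex.
From mathcomp Require Import all_classical all_reals all_analysis.
From mathcomp Require Import ring lra.

Import Order.TTheory GRing.Theory Num.Theory.
Import numFieldNormedType.Exports.

Local Open Scope classical_set_scope.
Local Open Scope ring_scope.

(** Everything rests on two inequalities: |Tr(XA)| <= ||X||_1 ||A||, and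
    ||X||_1 <= ||C||_1 for X in the closed orbit of C.

    If X is trace-norm close to U C U^*, then Z = U C' U^* lies in the orbit of
    C' and X - Z is a small error plus U (C - C') U^*, so that ||X - Z||_1 is
    at most ||C - C'||_1 up to that error ([closed_orbit_approx]).  Writing
    Tr(XA) - Tr(ZA') = Tr(X(A - A')) + Tr((X - Z)A') then puts, for each point
    of the first range, a point of the second one within
    ||C||_1 ||A - A'|| + ||C - C'||_1 ||A'|| + eps ([orbit_range_approx]).  The
    choices A = A' and C = C' give the two Lipschitz bounds, and the general
    case gives joint continuity.

    The properties of the trace norm used above (triangle inequality, unitary
    invariance, bound on the trace) all come from a duality, in which the
    trace norm is compared with sums of |<C e_n, W e_n>| over the fixed
    orthonormal basis (e_n):
    - such a sum is at most ||C||_1 for every contraction W, and more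
      generally sum_n |<C A e_n, W e_n>| <= ||A|| ||C||_1
      ([trace_pairing_le]);
    - for some contraction W, namely the partial isometry of the polar
      decomposition, it is at least ||C||_1 ([trace_norm_attained]).
    The first point factors C as V T T with V a contraction and T = |C|^(1/2),
    and uses that sum_n ||S e_n||^2 does not change when S is replaced by
    its adjoint, which is Parseval's identity and an exchange of sums.

    The operator theory needed for the factorization is obtained from a single
    Riesz lemma on the range of an operator ([riesz_range]), which gives
    both adjoints and polar decompositions, and from square roots of positive
    operators, built by an iteration that is compared with its scalar
    analogue. *)

Set Implicit Arguments.
Unset Strict Implicit.
Unset Printing Implicit Defensive.
Local Open Scope complex_scope.

(** * Norms and inner products with real values *)
Lemma ler_eps {R : realType} (a b : R) :
  (forall e : R, 0 < e -> a <= b + e) -> a <= b.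
Proof. by move=> ab; apply/ler_addgt0Pr. Qed.

Section norm.
Context {R : realType} {V : normedModType R[i]}.
Implicit Types x y z : V.

(** Norms take values in R[i]; moving to R makes the order total, so that linear
    arithmetic over R applies. *)
Lemma rnormE x : `|x| = (rnorm x)%:C.
Proof. by rewrite /rnorm RRe_real // ger0_real. Qed.

Lemma rnorm_ge0 x : 0 <= rnorm x.
Proof. by rewrite -ler0c -rnormE. Qed.

Lemma rnorm0 : rnorm (0 : V) = 0.
Proof. by rewrite /rnorm normr0. Qed.

Lemma rnorm_eq0 x : rnorm x = 0 -> x = 0.
Proof. by move=> x0; apply/eqP; rewrite -normr_eq0 rnormE x0. Qed.

Lemma rnormN x : rnorm (- x) = rnorm x.
Proof. by rewrite /rnorm normrN. Qed.

Lemma rnormB x y : rnorm (x - y) = rnorm (y - x).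
Proof. by rewrite /rnorm distrC. Qed.

Lemma rnormD x y : rnorm (x + y) <= rnorm x + rnorm y.
Proof.
by rewrite -lecR rmorphD /= -!rnormE ler_normD.
Qed.

Lemma rnormZ a x : rnorm (a *: x) = rnorm (a : R[i]^o) * rnorm x.
Proof.
by apply: (@complexI R); rewrite rmorphM /= -!rnormE normrZ.
Qed.

Lemma rnormZr (a : R) x : rnorm (a%:C *: x) = `|a| * rnorm x.
Proof.
rewrite rnormZ; congr (_ * _).
by rewrite /rnorm normc_def /= expr0n addr0 sqrtr_sqr.
Qed.

Lemma scale_half x : (2^-1%:C *: x) *+ 2 = x.
Proof.
rewrite scalerMnl -[RHS]scale1r; congr (_ *: _).
apply/eqP; rewrite eq_complex mulr2n /= addr0 eqxx andbT.
by apply/eqP; field.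
Qed.

Lemma rnorm_dist z x y : rnorm (x - y) <= rnorm (x - z) + rnorm (z - y).
Proof. by rewrite -[x - y](subrKA z) rnormD. Qed.
End norm.

Section scalars.
Context {R : realType}.
Implicit Types z : R[i]^o.

Lemma rnormcE z : rnorm z = Num.sqrt (complex.Re z ^+ 2 + complex.Im z ^+ 2).
Proof. by rewrite /rnorm normc_def. Qed.

Lemma sqr_rnormc z : rnorm z ^+ 2 = complex.Re z ^+ 2 + complex.Im z ^+ 2.
Proof. by rewrite rnormcE sqr_sqrtr // addr_ge0 ?sqr_ge0. Qed.

Lemma Re_le_rnorm z : `|complex.Re z| <= rnorm z.
Proof. 
by rewrite rnormcE -sqrtr_sqr ler_wsqrtr // lerDl sqr_ge0.
Qed.

Lemma Im_le_rnorm z : `|complex.Im z| <= rnorm z.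
Proof. 
by rewrite rnormcE -sqrtr_sqr ler_wsqrtr // lerDr sqr_ge0.
Qed.

Lemma rnormcM (a b : R[i]^o) : rnorm (a * b : R[i]^o) = rnorm a * rnorm b.
Proof. exact: rnormZ. Qed.

Lemma rnorm_conj z : rnorm (z^* : R[i]^o) = rnorm z.
Proof. by rewrite /rnorm normcJ. Qed.

Lemma rnorm_le_sum z : rnorm z <= `|complex.Re z| + `|complex.Im z|.
Proof.
rewrite -(ler_pXn2r (n := 2%N)) ?nnegrE ?rnorm_ge0 ?addr_ge0//.
rewrite sqr_rnormc sqrrD !real_normK ?num_real//.
by rewrite lerD2r lerDl mulrn_wge0// mulr_ge0.
Qed.

Lemma ReD z z' : complex.Re (z + z') = complex.Re z + complex.Re z'.
Proof. by case: z; case: z'. Qed.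
Lemma ImD z z' : complex.Im (z + z') = complex.Im z + complex.Im z'.
Proof. by case: z; case: z'. Qed.
Lemma ReN z : complex.Re (- z) = - complex.Re z.
Proof. by case: z. Qed.
Lemma ImN z : complex.Im (- z) = - complex.Im z.
Proof. by case: z. Qed.
Lemma ReJ (z : R[i]) : complex.Re (z^*%C) = complex.Re z.
Proof. by case: z. Qed.
Lemma ReZ (a : R) z : complex.Re (a%:C * z) = a * complex.Re z.
Proof. by case: z => x y /=; rewrite mul0r subr0. Qed.
Lemma Re_mulil z : complex.Re ('i%C * z) = - complex.Im z.
Proof. by case: z => x y /=; rewrite mul0r mul1r sub0r. Qed.
Lemma ReZJ (a : R) z : complex.Re ((a%:C)^*%C * z) = a * complex.Re z.
Proof. by rewrite conjc_real ReZ. Qed.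
End scalars.

Section hilbert.
Context {R : realType} {H : hilbertType R}.
Implicit Types (x y z : H) (a : R[i]).

Lemma innerDl x y z : inner (x + y) z = inner x z + inner y z.
Proof. exact: linearDl. Qed.
Lemma innerDr x y z : inner z (x + y) = inner z x + inner z y.
Proof. exact: linearD. Qed.
Lemma innerNl x z : inner (- x) z = - inner x z.
Proof. exact: linearNl. Qed.
Lemma innerNr x z : inner z (- x) = - inner z x.
Proof. exact: linearN. Qed.
Lemma innerBl x y z : inner (x - y) z = inner x z - inner y z.
Proof. by rewrite innerDl innerNl. Qed.
Lemma innerBr x y z : inner z (x - y) = inner z x - inner z y.
Proof. by rewrite innerDr innerNr. Qed.
Lemma inner0l z : inner (0 : H) z = 0.
Proof. exact: linear0l. Qed.
Lemma inner0r z : inner z (0 : H) = 0.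
Proof. exact: linear0. Qed.
Lemma innerZl a x z : inner (a *: x) z = a * inner x z.
Proof. exact: linearZl_LR. Qed.
Lemma innerZr a x z : inner z (a *: x) = a^*%C * inner z x.
Proof. exact: linearZr_LR. Qed.
Lemma innerC x y : inner x y = (inner y x)^*%C.
Proof. by rewrite (hermC (inner : {dot H for _})) /= expr0 mul1r. Qed.

(** The real part of the inner product: together with multiplication by 'i it
    determines the inner product, and it is a symmetric real bilinear form. *)
Definition rinner x y : R := complex.Re (inner x y).

Lemma rinnerC x y : rinner x y = rinner y x.
Proof. by rewrite /rinner innerC ReJ. Qed.
Lemma rinnerDl x y z : rinner (x + y) z = rinner x z + rinner y z.
Proof. by rewrite /rinner innerDl ReD. Qed.
Lemma rinnerDr x y z : rinner z (x + y) = rinner z x + rinner z y.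
Proof. by rewrite /rinner innerDr ReD. Qed.
Lemma rinnerBl x y z : rinner (x - y) z = rinner x z - rinner y z.
Proof. by rewrite /rinner innerBl ReD ReN. Qed.
Lemma rinnerBr x y z : rinner z (x - y) = rinner z x - rinner z y.
Proof. by rewrite /rinner innerBr ReD ReN. Qed.
Lemma rinnerZr (a : R) x z : rinner z (a%:C *: x) = a * rinner z x.
Proof. by rewrite /rinner innerZr ReZJ. Qed.
Lemma inner_norm_real x : inner x x = (rnorm x ^+ 2)%:C.
Proof. by rewrite inner_norm rnormE rmorphXn. Qed.
Lemma rinnerxx x : rinner x x = rnorm x ^+ 2.
Proof. by rewrite /rinner inner_norm_real. Qed.

Lemma inner_xx_eq0 x : inner x x = 0 -> x = 0.
Proof.
move=> x0; apply: rnorm_eq0; apply/eqP.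
by rewrite -sqrf_eq0 -rinnerxx /rinner x0.
Qed.

Lemma sqr_rnormD x y :
  rnorm (x + y) ^+ 2 = rnorm x ^+ 2 + 2 * rinner x y + rnorm y ^+ 2.
Proof.
by rewrite -!rinnerxx rinnerDl !rinnerDr (rinnerC y x); ring.
Qed.

Lemma sqr_rnormB x y :
  rnorm (x - y) ^+ 2 = rnorm x ^+ 2 - 2 * rinner x y + rnorm y ^+ 2.
Proof.
by rewrite -!rinnerxx rinnerBl !rinnerBr (rinnerC y x); ring.
Qed.

Lemma inner_CS x y : rnorm (inner x y : R[i]^o) <= rnorm x * rnorm y.
Proof.
have [/rnorm_eq0 ->|y0] := eqVneq (rnorm y) 0.
  by rewrite inner0r !rnorm0 mulr0 lexx.
have yp : 0 < rnorm y by rewrite lt_neqAle eq_sym y0 rnorm_ge0.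
set c : R[i]^o := inner x y.
pose t := rnorm y ^- 2.
have := sqr_ge0 (rnorm (x - (t%:C * c) *: y)).
rewrite sqr_rnormB rnormZ exprMn rnormcM exprMn.
have -> : rnorm (t%:C : R[i]^o) ^+ 2 = t ^+ 2.
  by rewrite sqr_rnormc /= expr0n addr0.
have -> : rinner x ((t%:C * c) *: y) = t * rnorm c ^+ 2.
  rewrite /rinner innerZr rmorphM /= -/c sqr_rnormc.
  by rewrite /t; case: c => a b /=; ring.
have h : t * rnorm y ^+ 2 = 1 by rewrite /t mulVf // expf_neq0.
move=> h1.
rewrite -(ler_pXn2r (n := 2%N)) ?nnegrE ?mulr_ge0 ?rnorm_ge0// exprMn.
set X := rnorm x; set Y := rnorm y in h *; set C := rnorm c.
have tp : 0 < t by rewrite /t invr_gt0 exprn_gt0.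
have h2 : 0 <= X ^+ 2 - t * C ^+ 2.
  apply: le_trans h1 _.
  have -> : t ^+ 2 * C ^+ 2 * Y ^+ 2 = (t * C ^+ 2) * (t * Y ^+ 2) by ring.
  by rewrite h mulr1; lra.
have : 0 <= (X ^+ 2 - t * C ^+ 2) * Y ^+ 2 by rewrite mulr_ge0 ?sqr_ge0.
have -> : (X ^+ 2 - t * C ^+ 2) * Y ^+ 2 = X ^+ 2 * Y ^+ 2 - C ^+ 2 * (t * Y ^+ 2).
  by ring.
by rewrite h mulr1 subr_ge0.
Qed.

Lemma rinner_CS x y : `|rinner x y| <= rnorm x * rnorm y.
Proof. exact: le_trans (Re_le_rnorm _) (inner_CS _ _). Qed.

Lemma parallelogram x y : rnorm (x - y) ^+ 2 =
  2 * rnorm x ^+ 2 + 2 * rnorm y ^+ 2 - 4 * rnorm (2^-1%:C *: (x + y)) ^+ 2.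
Proof.
rewrite rnormZr exprMn sqr_rnormB sqr_rnormD gtr0_norm ?invr_gt0//.
by field.
Qed.

End hilbert.

(** * Limits with real error bounds *)
Section convergence.
Context {R : realType}.

(** The error bound is in R, whereas the filters of a normed space over R[i] have
    theirs in R[i]. *)
Definition rcvg {V : normedModType R[i]} (u : nat -> V) (l : V) : Prop :=
  forall eps : R, 0 < eps ->
    exists N, forall n, (N <= n)%N -> rnorm (u n - l) <= eps.

Definition rcauchy {V : normedModType R[i]} (u : nat -> V) : Prop :=
  forall eps : R, 0 < eps ->
    exists N, forall m n, (N <= m)%N -> (N <= n)%N -> rnorm (u m - u n) <= eps.

Lemma nondecreasing_bounded_cauchy (b : nat -> R) (M : R) :
  (forall m n, (m <= n)%N -> b m <= b n) -> (forall n, b n <= M) ->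
  forall eps, 0 < eps -> exists N, forall n, (N <= n)%N -> b n - b N <= eps.
Proof.
move=> bincr bM eps eps0; pose E := [set b n | n in setT].
have supE : has_sup E.
  by split; [exists (b 0%N), 0%N|exists M => _ [n _ <-]].
have [_ [N _ <-] NE] := sup_adherent eps0 supE.
exists N => n _; have : b n <= sup E by apply: ub_le_sup; [case: supE|exists n].
by move: NE; lra.
Qed.

Lemma rcvgP {V : normedModType R[i]} (u : nat -> V) (l : V) :
  rcvg u l <-> u @ \oo --> l.
Proof.
split=> [ul|/cvgrPdist_le ul eps eps0].
  apply/cvgrPdist_le => e e0.
  have e0' : 0 < complex.Re e by move: e0; rewrite ltcE => /andP[].
  have [N uN] := ul _ e0'.
  exists N => // n /= Nn; rewrite distrC rnormE.
  rewrite -(RRe_real (gtr0_real e0)) lecR; exact: uN.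
have eps0' : 0 < eps%:C by rewrite ltcR.
have [N _ uN] := ul _ eps0'; exists N => n Nn.
by have := uN n Nn; rewrite distrC rnormE lecR.
Qed.

Lemma rcauchy_cvg {V : completeNormedModType R[i]} (u : nat -> V) :
  rcauchy u -> exists l, rcvg u l.
Proof.
move=> uc; exists (limn u); apply/rcvgP.
suff : cauchy (u @ \oo) by exact: cauchy_cvg.
apply: cauchy_exP => e e0.
have e0' : 0 < complex.Re e / 2.
  by move: e0; rewrite ltcE => /andP[_ /=] ?; rewrite divr_gt0.
have [N uN] := uc _ e0'.
exists (u N), N => // n /= Nn.
rewrite -ball_normE /ball_ /= rnormE -(RRe_real (gtr0_real e0)) ltcR.
apply: le_lt_trans (uN _ _ (leqnn N) Nn) _.
by move: e0'; lra.
Qed.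

Lemma rcvg_le {V : normedModType R[i]} (u : nat -> V) (l : V) (K : R) :
  rcvg u l -> (forall n, rnorm (u n) <= K) -> rnorm l <= K.
Proof.
move=> ul uK; apply: ler_eps => e e0.
have [N /(_ N (leqnn N)) uN] := ul _ e0.
have := rnormD (u N) (l - u N); rewrite addrC subrK rnormB.
by move: (uK N) uN; lra.
Qed.

Lemma rcvg_unique {V : normedModType R[i]} (u : nat -> V) (l l' : V) :
  rcvg u l -> rcvg u l' -> l = l'.
Proof.
by move=> /rcvgP ul /rcvgP ul'; exact: (cvg_unique _ ul ul').
Qed.

Lemma rcvgD {V : normedModType R[i]} (u v : nat -> V) (l m : V) :
  rcvg u l -> rcvg v m -> rcvg (fun n => u n + v n) (l + m).
Proof. by move=> /rcvgP ul /rcvgP vm; apply/rcvgP; exact: cvgD. Qed.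

Lemma rcvgN {V : normedModType R[i]} (u : nat -> V) (l : V) :
  rcvg u l -> rcvg (fun n => - u n) (- l).
Proof. by move=> /rcvgP ul; apply/rcvgP; exact: cvgN. Qed.

Lemma rcvgZ {V : normedModType R[i]} (a : R[i]) (u : nat -> V) (l : V) :
  rcvg u l -> rcvg (fun n => a *: u n) (a *: l).
Proof. by move=> /rcvgP ul; apply/rcvgP; exact: cvgZr. Qed.

Lemma rcvg_cst {V : normedModType R[i]} (l : V) : rcvg (fun=> l) l.
Proof. by apply/rcvgP; exact: cvg_cst. Qed.

Lemma rcvg_Lipschitz {V W : normedModType R[i]} (K : R) (f : V -> W)
    (u : nat -> V) (l : V) :
  (forall x y, rnorm (f x - f y) <= K * rnorm (x - y)) ->
  rcvg u l -> rcvg (f \o u) (f l).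
Proof.
move=> fK ul e e0.
have K1 : 0 < `|K| + 1 by rewrite ltr_wpDl.
have [N uN] := ul _ (divr_gt0 e0 K1); exists N => n Nn /=.
apply: le_trans (fK _ _) _.
have := uN n Nn; rewrite ler_pdivlMr// => h.
apply: le_trans _ h; rewrite mulrC ler_wpM2l ?rnorm_ge0//.
by have := ler_norm K; lra.
Qed.

End convergence.

Lemma rcvg_innerl {R : realType} {H : hilbertType R} (u : nat -> H) (l y : H) :
  rcvg u l -> rcvg (fun n => inner (u n) y : R[i]^o) (inner l y).
Proof.
apply: (@rcvg_Lipschitz _ _ _ (rnorm y) (fun x => inner x y : R[i]^o)) => x x'.
by rewrite -innerBl mulrC inner_CS.
Qed.

Section linear.
Context {K : pzRingType} {U V : lmodType K} {A : U -> V} (linA : linear A).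

Lemma lin0 : A 0 = 0.
Proof. by have := linA (-1) 0 0; rewrite !scaleN1r !addNr. Qed.
Lemma linD x y : A (x + y) = A x + A y.
Proof. by have := linA 1 x y; rewrite !scale1r. Qed.
Lemma linZ a x : A (a *: x) = a *: A x.
Proof. by have := linA a x 0; rewrite lin0 !addr0. Qed.
Lemma linN x : A (- x) = - A x.
Proof. by rewrite -scaleN1r linZ scaleN1r. Qed.
Lemma linB x y : A (x - y) = A x - A y.
Proof. by rewrite linD linN. Qed.
End linear.

(** * Riesz representation on the range of an operator *)
Section riesz.
Context {R : realType} {H : hilbertType R}.
Variables (P : H -> H) (psi : H -> R[i]^o) (K : R).
Hypotheses (linP : linear P) (lin_psi : linear psi) (K0 : 0 <= K).
Hypothesis psi_le : forall x, rnorm (psi x) <= K * rnorm (P x).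

(** For w representing psi, energy x + ||w||^2 = ||P x - w||^2, so that
    minimizing the energy amounts to approaching w from the range of P. *)
Definition energy x : R := rnorm (P x) ^+ 2 - 2 * complex.Re (psi x).

(** Completing the square in ||P x|| after psi_le. *)
Lemma energy_ge x : - K ^+ 2 <= energy x.
Proof.
have := psi_le x; have := le_trans (ler_norm _) (Re_le_rnorm (psi x)).
rewrite /energy => h1 h2.
have := sqr_ge0 (rnorm (P x) - K); rewrite sqrrB.
set p := rnorm (P x) in h2 *; set r := complex.Re _ in h1 *; nra.
Qed.

Definition inf_energy := inf [set energy x | x in setT].

Lemma inf_energy_lb x : inf_energy <= energy x.
Proof.
by apply: ge_inf; [exists (- K ^+ 2) => _ [y _ <-]; exact: energy_ge|exists x].
Qed.

Lemma energy_adherent (n : nat) : exists x, energy x < inf_energy + n.+1%:R^-1.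
Proof.
have [] := @inf_adherent _ [set energy x | x in setT] n.+1%:R^-1.
- by rewrite invr_gt0 ltr0n.
- split; first by exists (energy 0), 0.
  by exists (- K ^+ 2) => _ [y _ <-]; exact: energy_ge.
by move=> _ [x _ <-] ?; exists x.
Qed.

(** Since the midpoint has energy at least the infimum, this bounds the distance
    of two almost minimal points: minimizing sequences have Cauchy images. *)
Lemma energy_parallelogram x y : rnorm (P x - P y) ^+ 2 =
  2 * energy x + 2 * energy y - 4 * energy (2^-1%:C *: (x + y)).
Proof.
rewrite parallelogram /energy (linZ linP) (linZ lin_psi) (linD linP) (linD lin_psi).
by rewrite ReZ ReD; field.
Qed.

Lemma energy_translate x y (t : R) : energy (x + t%:C *: y) =
  energy x + 2 * t * (rinner (P y) (P x) - complex.Re (psi y)) +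
    t ^+ 2 * rnorm (P y) ^+ 2.
Proof.
rewrite /energy !(linD linP, linD lin_psi, linZ linP, linZ lin_psi) ReD ReZ.
rewrite sqr_rnormD rinnerZr rnormZr exprMn real_normK ?num_real//.
by rewrite (rinnerC (P x)); ring.
Qed.

Lemma invS_small (e : R) : 0 < e ->
  exists N, forall n, (N <= n)%N -> n.+1%:R^-1 <= e.
Proof.
move=> e0; exists (Num.bound e^-1) => n Nn.
rewrite -[leRHS]invrK lef_pV2 ?posrE ?invr_gt0 ?ltr0n//.
apply: le_trans (ltW (archi_boundP _)) _; first by rewrite invr_ge0 ltW.
by rewrite ler_nat (leq_trans Nn).
Qed.

(** The first variation at a minimum vanishes. *)
Lemma quadratic_ge0_eq0 (b q : R) : 0 <= q ->
  (forall t : R, 0 <= 2 * t * b + t ^+ 2 * q) -> b = 0.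
Proof.
move=> q0 /(_ (- b / (q + 1))).
have q1 : 0 < q + 1 by lra.
have -> : 2 * (- b / (q + 1)) * b + (- b / (q + 1)) ^+ 2 * q =
  - (b ^+ 2 * (q + 2)) / (q + 1) ^+ 2 by field; lra.
rewrite pmulr_lge0 ?invr_gt0 ?exprn_gt0// oppr_ge0 => h.
apply/eqP; rewrite -sqrf_eq0; apply/eqP/le_anti; rewrite sqr_ge0 andbT.
by have := sqr_ge0 b; nra.
Qed.

(** A functional on the domain of P that is dominated by ||P x|| is represented by
    a vector in the closure of the range of P.  The second clause, membership in
    the double orthogonal complement of the range, makes w unique.  For P = id
    this is the Riesz theorem that gives adjoints; for P = |C| and
    psi = <C _, y> it gives the partial isometry of the polar decomposition
    without extending an operator from a dense subspace. *)
Lemma riesz_range : exists w : H,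
  [/\ forall x, inner (P x) w = psi x,
      forall u, (forall x, inner (P x) u = 0) -> inner w u = 0 &
      rnorm w <= K].
Proof.
have [x xP] := choice energy_adherent.
have [w Pxw] : exists w, rcvg (P \o x) w.
  apply: rcauchy_cvg => e e0.
  have e40 : 0 < e ^+ 2 / 4 by rewrite divr_gt0 ?exprn_gt0.
  have [N NP] := invS_small e40; exists N => m n Nm Nn /=.
  rewrite -(ler_pXn2r (n := 2%N)) ?nnegrE ?rnorm_ge0 ?(ltW e0)//.
  rewrite energy_parallelogram.
  move: (xP m) (xP n) (NP m Nm) (NP n Nn).
  have := inf_energy_lb (2^-1%:C *: (x m + x n)).
  move: (m.+1%:R^-1) (n.+1%:R^-1) => a b; lra.
have realP y : rinner (P y) w = complex.Re (psi y).
  apply/eqP; rewrite -subr_eq0; apply/eqP.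
  apply: (@quadratic_ge0_eq0 _ (rnorm (P y) ^+ 2)) => [|t]; first exact: sqr_ge0.
  apply: ler_eps => e e0.
  have q0 : 0 < 2 * `|t| * rnorm (P y) + 1.
    by rewrite ltr_wpDl// !mulr_ge0 ?rnorm_ge0.
  have [N1 N1P] := invS_small (divr_gt0 e0 (ltr0Sn R 1)).
  have [N2 N2P] := Pxw _ (divr_gt0 (divr_gt0 e0 (ltr0Sn R 1)) q0).
  pose n := maxn N1 N2.
  have := N1P n (leq_maxl _ _); have := N2P n (leq_maxr _ _).
  rewrite ler_pdivlMr//= => h2 h1.
  have := inf_energy_lb (x n + t%:C *: y); rewrite energy_translate.
  have := xP n.
  have : `|rinner (P y) (P (x n) - w)| <= rnorm (P y) * rnorm (P (x n) - w).
    exact: rinner_CS.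
  rewrite rinnerBr => h3 h4 h5.
  have h6 : 2 * t * (rinner (P y) (P (x n)) - rinner (P y) w) <= e / 2.
    apply: le_trans (ler_norm _) _; rewrite !normrM normr_nat.
    apply: le_trans _ h2.
    have := normr_ge0 t; have := rnorm_ge0 (P y).
    have := rnorm_ge0 (P (x n) - w).
    move: h3.
    set D := rnorm (_ - _); set p := rnorm (P y); set a := `|t|.
    set g := `| _ |.
    by move=> g_le D0 p0 a0; have : a * g <= a * (p * D); [exact: ler_wpM2l|nra].
  have h7 : 2 * t * (rinner (P y) (P (x n)) - complex.Re (psi y)) =
    2 * t * (rinner (P y) (P (x n)) - rinner (P y) w) +
    2 * t * (rinner (P y) w - complex.Re (psi y)) by ring.
  move: h1 h4 h5; rewrite h7; move: (n.+1%:R^-1) h6 => ni; lra.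
have cvg0 := fun u => rcvg_innerl u Pxw.
exists w; split=> [y|u u0|].
- apply/eqP; rewrite eq_complex; apply/andP; split; apply/eqP; first exact: realP.
  have := realP ('i *: y).
  rewrite /rinner (linZ linP) (linZ lin_psi) innerZl.
  by rewrite (Re_mulil (psi y)) Re_mulil => /oppr_inj.
- apply: (rcvg_unique (cvg0 u)).
  rewrite (_ : (fun n => _) = fun=> 0); first exact: rcvg_cst.
  by apply/funext => n; exact: u0.
- have [->//|w0] := eqVneq (rnorm w) 0.
  have wp : 0 < rnorm w by rewrite lt_neqAle eq_sym w0 rnorm_ge0.
  rewrite -(ler_pM2r wp) -expr2; apply: ler_eps => e e0.
  have q0 : 0 < rnorm w + K by rewrite ltr_wpDr.
  have [N /(_ N (leqnn N)) NP] := Pxw _ (divr_gt0 e0 q0).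
  move: NP; rewrite ler_pdivlMr//= => NP.
  have := rinner_CS (P (x N) - w) w.
  rewrite rinnerBl realP rinnerxx ler_norml => /andP[h1 _].
  have h2 := le_trans (le_trans (ler_norm _) (Re_le_rnorm _)) (psi_le (x N)).
  have h3 : rnorm (P (x N)) <= rnorm w + rnorm (P (x N) - w).
    by have := rnormD w (P (x N) - w); rewrite addrC subrK.
  have h4 := ler_wpM2l K0 h3.
  by lra.
Qed.

End riesz.

(** * Bounded operators and adjoints *)
Section operators.
Context {R : realType} {H : hilbertType R}.
Implicit Types (A B C P S T U X Y : H -> H) (x y z : H) (K L : R).

(** An explicit bound replaces the extended-real operator norm in all estimates. *)
Definition op_le A K : Prop :=
  linear A /\ forall x, rnorm (A x) <= K * rnorm x.

Lemma op_leW K L A : K <= L -> op_le A K -> op_le A L.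
Proof.
move=> KL [linA AK]; split=> // x; apply: le_trans (AK x) _.
by rewrite ler_wpM2r ?rnorm_ge0.
Qed.

Lemma op_le_opnorm K A : 0 <= K -> op_le A K -> (opnorm A <= K%:E)%E.
Proof.
move=> K0 [_ AK]; apply: ge_ereal_sup => _ [x /= x1 <-].
rewrite lee_fin (le_trans (AK x))// ler_piMr//.
by move: x1; rewrite rnormE lecR.
Qed.

Lemma opnorm_ge0 A : (0 <= opnorm A)%E.
Proof.
apply: ereal_sup_ge; exists (rnorm (A 0))%:E => /=; last by rewrite lee_fin rnorm_ge0.
by exists 0 => //=; rewrite normr0 ler01.
Qed.

Lemma opnorm_fineK A : bounded_op A -> ((fine (opnorm A))%:E = opnorm A)%E.
Proof.
by case=> _ Aoo; rewrite fineK// ge0_fin_numE ?opnorm_ge0.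
Qed.

Lemma opnorm_op_le A : bounded_op A -> op_le A (fine (opnorm A)).
Proof.
move=> bA; have [linA _] := bA; split=> // x.
have [/rnorm_eq0 ->|x0] := eqVneq (rnorm x) 0.
  by rewrite lin0// !rnorm0 mulr0.
have xp : 0 < rnorm x by rewrite lt_neqAle eq_sym x0 rnorm_ge0.
rewrite -ler_pdivrMr// -lee_fin opnorm_fineK//.
apply: ereal_sup_ubound; exists ((rnorm x)^-1%:C *: x).
  by rewrite /= rnormE rnormZr gtr0_norm ?invr_gt0// mulVf.
by rewrite linZ// rnormZr gtr0_norm ?invr_gt0// mulrC.
Qed.

Lemma bounded_opP A : bounded_op A <-> exists2 K, 0 <= K & op_le A K.
Proof.
split=> [bA|[K K0 AK]].
  exists (fine (opnorm A)); last exact: opnorm_op_le.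
  by rewrite -lee_fin opnorm_fineK// opnorm_ge0.
split; first by case: AK.
by apply: le_lt_trans (op_le_opnorm K0 AK) _; rewrite ltry.
Qed.

Lemma op_le_id : op_le (id : H -> H) 1.
Proof. by split=> // x; rewrite mul1r. Qed.

Lemma op_le_comp K L A B :
  0 <= K -> op_le A K -> op_le B L -> op_le (A \o B) (K * L).
Proof.
move=> K0 [linA AK] [linB BL]; split=> [a x y /=|x /=].
  by rewrite linB linA.
by apply: le_trans (AK _) _; rewrite -mulrA ler_wpM2l.
Qed.

Lemma op_le_comp1 A B : op_le A 1 -> op_le B 1 -> op_le (A \o B) 1.
Proof. by move=> A1 B1; rewrite -[1](mulr1 1); apply: op_le_comp. Qed.

Lemma op_leD K L A B : op_le A K -> op_le B L -> op_le (A \+ B) (K + L).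
Proof.
move=> [linA AK] [linB BL]; split=> [a x y /=|x /=].
  by rewrite linA linB scalerDr addrACA.
by rewrite mulrDl (le_trans (rnormD _ _))// lerD.
Qed.

Lemma op_leN K A : op_le A K -> op_le (\- A) K.
Proof.
move=> [linA AK]; split=> [a x y /=|x /=]; last by rewrite rnormN.
by rewrite linA opprD scalerN.
Qed.

Lemma op_leB K L A B : op_le A K -> op_le B L -> op_le (A \- B) (K + L).
Proof. by move=> AK /op_leN; exact: op_leD. Qed.

Lemma op_leZ K (a : R) A : op_le A K -> op_le (fun x => a%:C *: A x) (`|a| * K).
Proof.
move=> [linA AK]; split=> [b x y /=|x /=].
  by rewrite linA scalerDr !scalerA (mulrC b).
by rewrite rnormZr -mulrA ler_wpM2l.
Qed.

Lemma bounded_op_comp A B : bounded_op A -> bounded_op B -> bounded_op (A \o B).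
Proof.
move=> /bounded_opP[K K0 AK] /bounded_opP[L L0 BL]; apply/bounded_opP.
by exists (K * L); [exact: mulr_ge0|exact: op_le_comp].
Qed.

Lemma bounded_opB A B : bounded_op A -> bounded_op B -> bounded_op (A \- B).
Proof.
move=> /bounded_opP[K K0 AK] /bounded_opP[L L0 BL]; apply/bounded_opP.
by exists (K + L); [exact: addr_ge0|exact: op_leB].
Qed.

Definition adjoint_pair A B : Prop := forall x y, inner (A x) y = inner x (B y).

Lemma adjoint_pair_sym A B : adjoint_pair A B -> adjoint_pair B A.
Proof. by move=> AB x y; rewrite innerC -AB -innerC. Qed.

Lemma inner_inj y z : (forall x, inner x y = inner x z) -> y = z.
Proof.
move=> yz; apply/eqP; rewrite -subr_eq0; apply/eqP/inner_xx_eq0.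
by rewrite innerBr yz subrr.
Qed.

Lemma adjoint_pair_linear A B : adjoint_pair A B -> linear B.
Proof.
move=> AB a x y; apply: inner_inj => z.
by rewrite -AB !innerDr !innerZr !AB.
Qed.

(** ||B y||^2 = <A B y, y> <= K ||B y|| ||y||. *)
Lemma adjoint_pair_op_le A B K : adjoint_pair A B -> op_le A K -> op_le B K.
Proof.
move=> AB [linA AK]; split; first exact: adjoint_pair_linear AB.
move=> y; have [->|By0] := eqVneq (rnorm (B y)) 0.
  exact: le_trans (rnorm_ge0 _) (AK y).
have Byp : 0 < rnorm (B y) by rewrite lt_neqAle eq_sym By0 rnorm_ge0.
rewrite -(ler_pM2l Byp) -expr2 -rinnerxx /rinner -AB.
apply: le_trans (le_trans (ler_norm _) (rinner_CS _ _)) _.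
by rewrite mulrA ler_wpM2r ?rnorm_ge0// mulrC AK.
Qed.

Lemma adjoint_exists A K : 0 <= K -> op_le A K -> exists B, adjoint_pair A B.
Proof.
move=> K0 [linA AK].
have rep y : exists w, forall x, inner (A x) y = inner x w.
  have [||||w [wP _ _]] := @riesz_range R H id (fun x => inner (A x) y) (K * rnorm y).
  - by [].
  - by move=> a x z; rewrite linA innerDl innerZl.
  - by rewrite mulr_ge0 ?rnorm_ge0.
  - move=> x; apply: le_trans (inner_CS _ _) _.
    by rewrite mulrAC ler_wpM2r ?rnorm_ge0.
  by exists w => x; rewrite -wP.
by have [B BP] := choice rep; exists B => x y; exact: BP.
Qed.

Lemma adjointP A : bounded_op A -> bounded_op (adjoint A) /\ adjoint_pair A (adjoint A).
Proof.
move=> /bounded_opP[K K0 AK]; rewrite /adjoint; case: xgetP => [_ _ //|/= none].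
have [B AB] := adjoint_exists K0 AK.
exfalso; apply: (none B); split=> //; apply/bounded_opP; exists K => //.
exact: adjoint_pair_op_le AB AK.
Qed.

(** Polarization: <P z, z> is real for z = x + y and for z = 'i x + y. *)
Lemma positive_op_self_adjoint P : positive_op P -> adjoint_pair P P.
Proof.
move=> [[linP _] P0] .
have ImP x : complex.Im (inner (P x) x) = 0 by apply: ger0_Im.
have ImE x y : complex.Im (inner (P x) y) = complex.Im (inner x (P y)).
  have := ImP (x + y); rewrite (linD linP) innerDl !innerDr !ImD !ImP add0r addr0.
  rewrite (innerC (P y) x).
  by case: (inner x (P y)) => a b /=; move/eqP; rewrite subr_eq0 => /eqP.
move=> x y; apply/eqP; rewrite eq_complex ImE eqxx andbT; apply/eqP.
have := ImE ('i *: x) y; rewrite (linZ linP) !innerZl.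
case: (inner (P x) y) => a b; case: (inner x (P y)) => c d /=.
by rewrite !mul0r !mul1r !add0r.
Qed.

End operators.

(** * Square roots of positive operators *)
Section square_root_contraction.
Context {R : realType} {H : hilbertType R}.
Variable B : H -> H.
Hypotheses (B1 : op_le B 1) (BB : adjoint_pair B B).

(** If T = 1 - Y and A = 1 - B, then T^2 = A means Y = (B + Y^2) / 2.  The iterates
    of this fixed point equation are dominated by those of its scalar analogue
    for B = 1, which increase to 1. *)
Fixpoint sqrt_iter (n : nat) : H -> H :=
  if n is n'.+1 then
    fun x => 2^-1%:C *: (B x + sqrt_iter n' (sqrt_iter n' x))
  else fun=> 0.

Fixpoint sqrt_bound (n : nat) : R :=
  if n is n'.+1 then (1 + sqrt_bound n' ^+ 2) / 2 else 0.

Lemma sqrt_bound_itv n : 0 <= sqrt_bound n <= 1.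
Proof.
elim: n => [|n /andP[h0 h1]] /=; first by rewrite lexx ler01.
have : sqrt_bound n ^+ 2 <= 1 by rewrite expr_le1.
by have := sqr_ge0 (sqrt_bound n); lra.
Qed.

Lemma sqrt_bound_le1 n : sqrt_bound n <= 1.
Proof. by have /andP[] := sqrt_bound_itv n. Qed.

Lemma sqrt_iter_linear n : linear (sqrt_iter n).
Proof.
have [linB _] := B1; elim: n => [|n IH] a x y /=; first by rewrite scaler0 addr0.
rewrite !IH linB !scalerDr !scalerA mulrC.
by rewrite !addrA; congr (_ + _); rewrite -!addrA; congr (_ + _); rewrite addrC.
Qed.

Lemma sqrt_iter_op_le n : op_le (sqrt_iter n) (sqrt_bound n).
Proof.
split; first exact: sqrt_iter_linear.
have [linB B1'] := B1; elim: n => [|n IH] x /=; first by rewrite rnorm0 mul0r.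
rewrite rnormZr gtr0_norm ?invr_gt0//.
have := rnormD (B x) (sqrt_iter n (sqrt_iter n x)).
have := B1' x; have := IH x; have := IH (sqrt_iter n x).
have /andP[b0 b1] := sqrt_bound_itv n.
move=> h1 h2 h3 h4.
have := ler_wpM2l b0 h2; lra.
Qed.

Lemma sqrt_iter_le1 n x : rnorm (sqrt_iter n x) <= rnorm x.
Proof.
have [_ /(_ x) h] := sqrt_iter_op_le n; apply: le_trans h _.
by have /andP[b0 b1] := sqrt_bound_itv n; rewrite ler_piMl ?rnorm_ge0.
Qed.

Lemma sqrt_iter_comm (D : H -> H) n : linear D -> (forall x, D (B x) = B (D x)) ->
  forall x, D (sqrt_iter n x) = sqrt_iter n (D x).
Proof.
move=> lD DB; elim: n => [|n IH] x /=; first by rewrite (lin0 lD).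
by rewrite (linZ lD) (linD lD) DB !IH.
Qed.

Lemma sqrt_iter_commute m n x :
  sqrt_iter m (sqrt_iter n x) = sqrt_iter n (sqrt_iter m x).
Proof.
have [linB _] := B1.
apply: sqrt_iter_comm => [|y]; first exact: sqrt_iter_linear.
by rewrite -sqrt_iter_comm.
Qed.

(** All iterates are polynomials in B, hence commute, and the increments satisfy
    the recursion of the scalar increments with <= in place of =. *)
Lemma sqrt_iter_step n x : rnorm (sqrt_iter n.+1 x - sqrt_iter n x) <=
  (sqrt_bound n.+1 - sqrt_bound n) * rnorm x.
Proof.
elim: n x => [|n IH] x.
  have [_ h] := sqrt_iter_op_le 1.
  by rewrite [sqrt_iter 0 x]/= [sqrt_bound 0]/= !subr0; exact: h.
have lin_n := sqrt_iter_linear n; have lin_n1 := sqrt_iter_linear n.+1.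
pose D y := sqrt_iter n.+1 y - sqrt_iter n y.
(* this is a^2 - b^2 = (a + b) (a - b) for the commuting iterates *)
have -> : sqrt_iter n.+2 x - sqrt_iter n.+1 x =
    2^-1%:C *: (sqrt_iter n.+1 (D x) + sqrt_iter n (D x)).
  rewrite [sqrt_iter n.+2 x]/= -/(sqrt_iter n.+1) [X in _ - X]/=.
  rewrite -scalerBr opprD addrACA subrr add0r /D (linB lin_n1) (linB lin_n).
  rewrite -/(sqrt_iter n.+1 _) (sqrt_iter_commute n n.+1) addrA subrK.
  by [].
rewrite rnormZr gtr0_norm ?invr_gt0//.
have := rnormD (sqrt_iter n.+1 (D x)) (sqrt_iter n (D x)).
have [_ /(_ (D x)) h1] := sqrt_iter_op_le n.+1.
have [_ /(_ (D x)) h2] := sqrt_iter_op_le n.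
have /andP[a0 a1] := sqrt_bound_itv n.+1.
have /andP[b0 b1] := sqrt_bound_itv n.
move=> h3.
have ab0 : 0 <= sqrt_bound n.+1 + sqrt_bound n by rewrite addr_ge0.
have h4 := ler_wpM2l ab0 (IH x).
have -> : sqrt_bound n.+2 - sqrt_bound n.+1 =
  2^-1 * ((sqrt_bound n.+1 + sqrt_bound n) * (sqrt_bound n.+1 - sqrt_bound n)).
  have boundS k : sqrt_bound k.+1 = (1 + sqrt_bound k ^+ 2) / 2 by [].
  by rewrite (boundS n.+1) {2}(boundS n); field.
rewrite -!mulrA ler_pM2l ?invr_gt0//.
apply: le_trans _ h4; rewrite mulrDl -/(D x).
by apply: le_trans h3 _; rewrite lerD.
Qed.

Lemma sqrt_iter_dist n k x : rnorm (sqrt_iter (n + k) x - sqrt_iter n x) <=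
  (sqrt_bound (n + k) - sqrt_bound n) * rnorm x.
Proof.
elim: k => [|k IH]; first by rewrite addn0 !subrr rnorm0 mul0r.
apply: le_trans (rnorm_dist (sqrt_iter (n + k) x) _ _) _.
have := sqrt_iter_step (n + k) x; rewrite addnS; move: IH; lra.
Qed.

Lemma sqrt_bound_ndecr m n : (m <= n)%N -> sqrt_bound m <= sqrt_bound n.
Proof.
elim: n m => [|n IH] m; first by rewrite leqn0 => /eqP ->.
have step : forall k, sqrt_bound k <= sqrt_bound k.+1.
  by move=> k /=; have := sqr_ge0 (sqrt_bound k - 1); rewrite sqrrB1; lra.
by rewrite leq_eqVlt => /orP[/eqP -> //|]; rewrite ltnS => /IH /le_trans; apply.
Qed.

Lemma sqrt_iter_cauchy x : rcauchy (fun n => sqrt_iter n x).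
Proof.
move=> e e0.
have x1 : 0 < rnorm x + 1 by rewrite ltr_wpDl ?rnorm_ge0.
have e2 : 0 < e / 2 / (rnorm x + 1) by rewrite !divr_gt0.
have [N NP] := nondecreasing_bounded_cauchy sqrt_bound_ndecr sqrt_bound_le1 e2.
have NN n : (N <= n)%N -> rnorm (sqrt_iter n x - sqrt_iter N x) <= e / 2.
  move=> Nn; have := sqrt_iter_dist N (n - N) x; rewrite subnKC// => h.
  apply: le_trans h _; have := NP n Nn; rewrite ler_pdivlMr// => h.
  apply: le_trans _ h; rewrite ler_wpM2l ?lerDl//.
  by rewrite subr_ge0 sqrt_bound_ndecr.
exists N => m n Nm Nn.
have := rnorm_dist (sqrt_iter N x) (sqrt_iter m x) (sqrt_iter n x).
have := NN m Nm; have := NN n Nn; rewrite (rnormB (sqrt_iter n x)); lra.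
Qed.

Lemma sqrt_iter_self_adjoint n : adjoint_pair (sqrt_iter n) (sqrt_iter n).
Proof.
elim: n => [|n IH] x y /=; first by rewrite inner0l inner0r.
by rewrite innerZl innerZr conjc_real innerDl innerDr BB !IH.
Qed.

Lemma sqrt_limit : exists Y : H -> H,
  [/\ op_le Y 1, adjoint_pair Y Y & forall x, Y x *+ 2 = B x + Y (Y x)].
Proof.
have [Y YP] := choice (fun x => rcauchy_cvg (sqrt_iter_cauchy x)).
have linY : linear Y.
  move=> a x y; apply: rcvg_unique (YP _) _.
  rewrite (_ : (fun n => _) = fun n => a *: sqrt_iter n x + sqrt_iter n y).
    by apply: rcvgD => //; exact: rcvgZ.
  by apply/funext => n; exact: sqrt_iter_linear.
have Y1 x : rnorm (Y x) <= rnorm x.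
  by apply: rcvg_le (YP x) _ => n; exact: sqrt_iter_le1.
exists Y; split.
- by split=> // x; rewrite mul1r.
- move=> x y; apply: rcvg_unique (rcvg_innerl y (YP x)) _.
  rewrite (_ : (fun n => _) = fun n => (inner (sqrt_iter n y) x)^*%C).
    rewrite innerC.
    apply: (@rcvg_Lipschitz _ R[i]^o R[i]^o 1 (fun z => z^*%C)) (rcvg_innerl x (YP y)) => z z'.
    by rewrite mul1r -rmorphB rnorm_conj.
  by apply/funext => n; rewrite sqrt_iter_self_adjoint innerC.
- move=> x.
  have YY : rcvg (fun n => sqrt_iter n (sqrt_iter n x)) (Y (Y x)).
    move=> e e0; have e2 : 0 < e / 2 by rewrite divr_gt0.
    have [N1 h1] := YP x _ e2; have [N2 h2] := YP (Y x) _ e2.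
    exists (maxn N1 N2) => n; rewrite geq_max => /andP[n1 n2].
    apply: le_trans (rnorm_dist (sqrt_iter n (Y x)) _ _) _.
    rewrite [leRHS](splitr e) lerD ?h2// -(linB (sqrt_iter_linear n)).
    exact: le_trans (sqrt_iter_le1 _ _) (h1 n n1).
  have h1 : rcvg (fun n => sqrt_iter n.+1 x) (Y x).
    move=> e e0; have [N h] := YP x _ e0; exists N => n Nn; apply: h.
    exact: leqW.
  have h2 : rcvg (fun n => sqrt_iter n.+1 x) (2^-1%:C *: (B x + Y (Y x))).
    by apply: rcvgZ; apply: rcvgD => //; exact: rcvg_cst.
  by rewrite -[RHS]scale_half -(rcvg_unique h1 h2).
Qed.

End square_root_contraction.

Section square_root.
Context {R : realType} {H : hilbertType R}.
Implicit Types (A B C P S T U X Y : H -> H) (x y z : H) (K L : R).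

(** Positivity of A at x - A x gives 0 <= <A x, x> - 2 ||A x||^2 + <A A x, A x>, and
    the last term is at most ||A x||^2. *)
Lemma positive_op_sqr_le A x : positive_op A -> op_le A 1 ->
  rnorm (A x) ^+ 2 <= rinner (A x) x.
Proof.
move=> A0 [linA A1]; have AA := positive_op_self_adjoint A0.
have [_ /(_ (x - A x))] := A0.
rewrite lecE => /andP[_]; rewrite -/(rinner _ _) /=.
rewrite (linB linA) rinnerBl !rinnerBr (_ : rinner (A (A x)) x = rnorm (A x) ^+ 2).
  have := rinner_CS (A (A x)) (A x); rewrite ler_norml => /andP[_].
  rewrite rinnerxx.
  have := A1 (A x); have := rnorm_ge0 (A x); nra.
by rewrite /rinner AA -/(rinner _ _) rinnerxx.
Qed.

(** By [positive_op_sqr_le] 1 - A is again a contraction, so that the iteration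
    applies to it. *)
Lemma sqrt_contraction A : positive_op A -> op_le A 1 ->
  exists2 T, positive_op T & T \o T = A.
Proof.
move=> A0 A1; have AA := positive_op_self_adjoint A0; have [linA _] := A1.
pose B x := x - A x.
have B1 : op_le B 1.
  split=> [a x y|x]; first by rewrite /B linA scalerBr opprD addrACA.
  rewrite mul1r -(ler_pXn2r (n := 2%N)) ?nnegrE ?rnorm_ge0//.
  rewrite sqr_rnormB rinnerC.
  by have := positive_op_sqr_le x A0 A1; have := sqr_ge0 (rnorm (A x)); lra.
have BB : adjoint_pair B B by move=> x y; rewrite innerBl innerBr AA.
have [Y [Y1 YY YE]] := sqrt_limit B1 BB; have [linY Y1'] := Y1.
exists (fun x => x - Y x).
  split.
    by apply/bounded_opP; exists (1 + 1) => //; apply: op_leB => //; exact: op_le_id.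
  move=> x; rewrite lecE; apply/andP; split.
    rewrite innerBl ImD ImN inner_norm_real /= sub0r.
    have : inner (Y x) x = (inner (Y x) x)^*%C by rewrite {1}YY innerC.
    case: (inner _ _) => a b /= [] /eqP; rewrite -subr_eq0 opprK -mulr2n.
    by rewrite mulrn_eq0 /= oppr_eq0.
  rewrite -/(rinner _ _) rinnerBl rinnerxx /= subr_ge0.
  apply: le_trans (le_trans (ler_norm _) (rinner_CS _ _)) _.
  by rewrite expr2 ler_wpM2r ?rnorm_ge0// (le_trans (Y1' x)) ?mul1r.
apply/funext => x /=; rewrite (linB linY) opprB.
have -> : Y (Y x) = Y x *+ 2 - B x by rewrite YE addrAC subrr add0r.
rewrite /B opprB mulr2n [_ + (A x - x) - _]addrAC addrK addrA subrK.
by rewrite addrC subrK.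
Qed.

Lemma positive_opZ (a : R) P : 0 <= a -> positive_op P ->
  positive_op (fun x => a%:C *: P x).
Proof.
move=> a0 [/bounded_opP[K K0 PK] P0]; split=> [|x].
  apply/bounded_opP; exists (`|a| * K); first exact: mulr_ge0.
  exact: op_leZ.
by rewrite innerZl mulr_ge0// ler0c.
Qed.

(** Rescaling reduces to a contraction. *)
Lemma sqrt_exists P : positive_op P -> exists2 T, positive_op T & T \o T = P.
Proof.
move=> P0; have [/bounded_opP[K K0 PK] _] := P0.
have k0 : 0 < K + 1 by rewrite ltr_wpDl.
have [||T [bT T0] TT] := @sqrt_contraction (fun x => (K + 1)^-1%:C *: P x).
- by apply: positive_opZ => //; rewrite invr_ge0 ltW.
- apply: (@op_leW _ _ (`|(K + 1)^-1| * K)); last exact: op_leZ.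
  by rewrite gtr0_norm ?invr_gt0// mulrC ler_pdivrMr// mul1r lerDl.
exists (fun x => (Num.sqrt (K + 1))%:C *: T x).
  by apply: positive_opZ; rewrite ?sqrtr_ge0.
have [linT _] := bT.
apply/funext => x /=; rewrite (linZ linT) scalerA -rmorphM /= -expr2.
rewrite sqr_sqrtr ?(ltW k0)// -[T (T x)]/((T \o T) x) TT scalerA -rmorphM /=.
by rewrite divff ?gt_eqF// scale1r.
Qed.

Lemma positive_op_adjoint_comp C : bounded_op C -> positive_op (adjoint C \o C).
Proof.
move=> bC; have [bC' CC'] := adjointP bC.
split=> [|x]; first exact: bounded_op_comp.
by rewrite /= innerC -CC' inner_norm_real conjc_real ler0c sqr_ge0.
Qed.

Lemma abs_opP C : bounded_op C ->
  positive_op (abs_op C) /\ abs_op C \o abs_op C = adjoint C \o C.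
Proof.
move=> bC; rewrite /abs_op; case: xgetP => [_ _ //|/= none].
have [T T0 TT] := sqrt_exists (positive_op_adjoint_comp bC).
by exfalso; exact: (none T).
Qed.

(** * Polar decomposition *)
Lemma inner_abs_op C x y : bounded_op C ->
  inner (abs_op C x) (abs_op C y) = inner (C x) (C y).
Proof.
move=> bC; have [P0 PP] := abs_opP bC; have [bC' CC'] := adjointP bC.
rewrite (positive_op_self_adjoint P0) -[abs_op C (abs_op C y)]/((_ \o _) y) PP.
by rewrite CC'.
Qed.

Lemma rnorm_abs_op C x : bounded_op C -> rnorm (abs_op C x) = rnorm (C x).
Proof.
move=> bC; apply/eqP; rewrite -(eqrXn2 (n := 2%N)) ?rnorm_ge0//.
by rewrite -!rinnerxx /rinner inner_abs_op.
Qed.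

(** V' y is the vector of the closed range of |C| representing |C| x |-> <C x, y>;
    this functional is well defined with norm at most ||y|| because
    || |C| x || = ||C x||. *)
Lemma polar_decomposition C : bounded_op C -> exists V V' : H -> H,
  [/\ op_le V 1, adjoint_pair V V', V \o abs_op C = C & V' \o C = abs_op C].
Proof.
move=> bC; have [linC _] := bC; have [[[linP _] P0] PP] := abs_opP bC.
have [bC' CC'] := adjointP bC.
set P := abs_op C in linP P0 PP *.
have PK := @rnorm_abs_op C _ bC.
have rep y : exists w, [/\ forall x, inner (P x) w = inner (C x) y,
    forall u, (forall x, inner (P x) u = 0) -> inner w u = 0 & rnorm w <= rnorm y].
  apply: (@riesz_range R H P (fun x => inner (C x) y) (rnorm y)) => //.
  - by move=> a x z; rewrite linC innerDl innerZl.
  - exact: rnorm_ge0.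
  - by move=> x; apply: le_trans (inner_CS _ _) _; rewrite -PK mulrC.
have [V' V'P] := choice rep.
have V'uniq y w : (forall x, inner (P x) w = inner (C x) y) ->
    (forall u, (forall x, inner (P x) u = 0) -> inner w u = 0) -> V' y = w.
  move=> w1 w2; have [v1 v2 _] := V'P y.
  have perp x : inner (P x) (V' y - w) = 0 by rewrite innerBr v1 w1 subrr.
  apply/eqP; rewrite -subr_eq0; apply/eqP/inner_xx_eq0.
  by rewrite innerBl v2// w2// subrr.
have linV' : linear V'.
  move=> a y z; apply: V'uniq => [x|u u0].
    have [v1 _ _] := V'P y; have [w1 _ _] := V'P z.
    by rewrite !innerDr !innerZr v1 w1.
  have [_ v2 _] := V'P y; have [_ w2 _] := V'P z.
  by rewrite innerDl innerZl v2// w2// mulr0 addr0.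
have V'1 : op_le V' 1.
  by split=> // y; rewrite mul1r; have [] := V'P y.
have [V V'V] := adjoint_exists ler01 V'1.
have VV' := adjoint_pair_sym V'V.
exists V, V'; split=> //.
- exact: adjoint_pair_op_le V'V V'1.
- apply/funext => x /=; apply: inner_inj => z; rewrite -V'V.
  by rewrite innerC; have [-> _ _] := V'P z; rewrite -innerC.
- apply/funext => x /=; apply: V'uniq => [y|u]; last exact.
  by rewrite inner_abs_op.
Qed.

(** Taking T = |C|^(1/2) splits the pairing <C x, y> as <T x, T V' y>, which turns
    trace norm estimates into Hilbert-Schmidt estimates. *)
Lemma trace_class_factorization C : bounded_op C -> exists T V V' : H -> H,
  [/\ bounded_op T, adjoint_pair T T, op_le V 1 & adjoint_pair V V'] /\
  [/\ forall x, abs_op C x = T (T x), forall x, C x = V (T (T x)) &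
      forall x, V' (C x) = T (T x)].
Proof.
move=> bC; have [P0 _] := abs_opP bC.
have [T T0 TT] := sqrt_exists P0; have [V [V' [V1 VV' VP V'C]]] := polar_decomposition bC.
exists T, V, V'; split; split=> //.
- by case: T0.
- exact: positive_op_self_adjoint.
- by move=> x; rewrite -TT.
- by move=> x; rewrite -[in LHS]VP -TT.
- by move=> x; rewrite -[LHS]/((V' \o C) x) V'C -TT.
Qed.

End square_root.

(** * Orthonormal bases and Parseval's identity *)
Section orthonormal_bases.
Context {R : realType} {H : hilbertType R}.
Implicit Types (e d : nat -> H) (x y z : H).

Definition proj e n x : H := \sum_(k < n) inner x (e k) *: e k.

Lemma projS e n x : proj e n.+1 x = proj e n x + inner x (e n) *: e n.
Proof. by rewrite /proj big_ord_recr. Qed.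

(** Null vectors are allowed in e, and orthogonality is only required below n so
    that the lemma applies in the middle of the Gram-Schmidt process. *)
Lemma inner_proj e n x j : e j = 0 \/ `|e j| = 1 ->
  (forall i, (i < n)%N -> i != j -> inner (e i) (e j) = 0) ->
  inner (proj e n x) (e j) = if (j < n)%N then inner x (e j) else 0.
Proof.
move=> ej; elim: n => [|n IH] orth; first by rewrite /proj big_ord0 inner0l.
rewrite projS innerDl innerZl IH; last by move=> i ni; apply: orth; rewrite leqW.
rewrite ltnS [in RHS]leq_eqVlt; have [jE|jn] := eqVneq j n.
  rewrite -jE ltnn add0r /=; case: ej => [->|e1]; first by rewrite !inner0r mulr0.
  by rewrite inner_norm e1 expr1n mulr1.
by rewrite orth//= 1?eq_sym// mulr0 addr0.
Qed.

(** As 0^-1 = 0 the null vector is normalized to itself, which is how null vectors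
    enter the basis. *)
Definition normalize x : H := (rnorm x)^-1%:C *: x.

Lemma normalizeK x : (rnorm x)%:C *: normalize x = x.
Proof.
rewrite /normalize scalerA -rmorphM /=.
have [x0|x0] := eqVneq (rnorm x) 0; first by rewrite (rnorm_eq0 x0) scaler0.
by rewrite mulfV// scale1r.
Qed.

Lemma normalize_norm x : normalize x = 0 \/ `|normalize x| = 1.
Proof.
have [x0|x0] := eqVneq (rnorm x) 0.
  by left; rewrite /normalize (rnorm_eq0 x0) scaler0.
by right; rewrite rnormE rnormZr ger0_norm ?invr_ge0 ?rnorm_ge0// mulVf.
Qed.

Fixpoint gram_schmidt_seq d n : seq H :=
  if n is m.+1 then
    let s := gram_schmidt_seq d m in
    rcons s (normalize (d m - \sum_(u <- s) inner (d m) u *: u))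
  else [::].

Definition gram_schmidt d n : H :=
  normalize (d n - \sum_(u <- gram_schmidt_seq d n) inner (d n) u *: u).

Lemma gram_schmidt_seqE d n : gram_schmidt_seq d n = mkseq (gram_schmidt d) n.
Proof. by elim: n => [|n IH] //; rewrite mkseqS -IH. Qed.

Lemma gram_schmidtE d n :
  gram_schmidt d n = normalize (d n - proj (gram_schmidt d) n (d n)).
Proof.
rewrite /gram_schmidt gram_schmidt_seqE; congr (normalize (_ - _)).
by rewrite big_map /proj -(subn0 n) -/(index_iota 0 n) big_mkord subn0.
Qed.

Lemma gram_schmidt_orth d i j : i != j ->
  inner (gram_schmidt d i) (gram_schmidt d j) = 0.
Proof.
set e := gram_schmidt d.
suff orth n : forall i, (i < n)%N -> inner (e n) (e i) = 0.
  rewrite neq_ltn => /orP[ij|ij]; last exact: orth.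
  by rewrite innerC orth// conjc0.
elim/ltn_ind: n {i j} => n IH i ni.
rewrite {1}/e gram_schmidtE -/e innerZl innerBl inner_proj.
- by rewrite ni subrr mulr0.
- exact: normalize_norm.
move=> k kn; rewrite neq_ltn => /orP[ki|ki]; last exact: IH.
by rewrite innerC IH// conjc0.
Qed.

Lemma gram_schmidt_total d x :
  (forall n, inner x (gram_schmidt d n) = 0) -> forall n, inner x (d n) = 0.
Proof.
move=> xe n; rewrite -[d n](subrK (proj (gram_schmidt d) n (d n))).
rewrite innerDr -[_ - _]normalizeK -gram_schmidtE innerZr xe mulr0 add0r /proj.
elim/big_ind: _ => [|y z y0 z0|i _]; first exact: inner0r.
  by rewrite innerDr y0 z0 addr0.
by rewrite innerZr xe mulr0.
Qed.

(** Gram-Schmidt on an enumeration of a countable dense set: a vector orthogonal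
    to the output is orthogonal to the dense set. *)
Lemma orthonormal_basis_exists :
  separable H -> exists e : nat -> H, orthonormal_basis e.
Proof.
move=> [D /countable_injP[f finj] dD].
pose d n := xget 0 [set x | D x /\ f x = n].
exists (gram_schmidt d); split.
- exact: gram_schmidt_orth.
- by move=> i; rewrite gram_schmidtE; exact: normalize_norm.
move=> x /gram_schmidt_total xd.
have xD y : D y -> inner x y = 0.
  move=> Dy; rewrite (_ : y = d (f y))//; rewrite /d; case: xgetP => [z _ [Dz fz]|/(_ y)].
    by apply: finj; rewrite ?inE.
  by case.
have [/rnorm_eq0//|x0] := eqVneq (rnorm x) 0.
have xp : 0 < rnorm x by rewrite lt_neqAle eq_sym x0 rnorm_ge0.
have e0 : 0 < (rnorm x)%:C by rewrite ltcR.
have [|y [/= xy Dy]] := dD (ball x (rnorm x)%:C) _ (ball_open _ _).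
  by exists x; exact: ballxx.
move: xy; rewrite -ball_normE /ball_ /= rnormE ltcR => xy.
have := rinner_CS x (x - y).
rewrite rinnerBr rinnerxx [rinner x y]/rinner xD//= subr0.
rewrite ger0_norm ?sqr_ge0// expr2 ler_pM2l// => h.
by have := lt_le_trans xy h; rewrite ltxx.
Qed.

Lemma hilbert_basisP : separable H -> orthonormal_basis (hilbert_basis : nat -> H).
Proof.
move=> sH; rewrite /hilbert_basis; case: xgetP => [//|/= none].
by have [e eP] := orthonormal_basis_exists sH; exfalso; exact: (none e).
Qed.

Section parseval.
Variables (e : nat -> H) (eP : orthonormal_basis e).

Lemma inner_basis_proj n x j :
  inner (proj e n x) (e j) = if (j < n)%N then inner x (e j) else 0.
Proof. by have [orth unit _] := eP; apply: inner_proj => // i _; exact: orth. Qed.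

Lemma rnorm_component x k :
  rnorm (inner x (e k) *: e k) = rnorm (inner x (e k) : R[i]^o).
Proof.
rewrite rnormZ; have [_ /(_ k)[->|e1] _] := eP; first by rewrite inner0r !rnorm0 mul0r.
by rewrite [rnorm (e k)]/rnorm e1 mulr1.
Qed.

Lemma inner_scale_conj x y : rinner x (inner x y *: y) = rnorm (inner x y : R[i]^o) ^+ 2.
Proof.
rewrite sqr_rnormc /rinner innerZr.
by case: (inner x y) => a b /=; ring.
Qed.

Lemma bessel n x : rnorm (x - proj e n x) ^+ 2 =
  rnorm x ^+ 2 - \sum_(0 <= k < n) rnorm (inner x (e k) : R[i]^o) ^+ 2.
Proof.
elim: n => [|n IH]; first by rewrite /proj big_ord0 big_geq// !subr0.
rewrite projS opprD addrA sqr_rnormB IH big_nat_recr//= rnorm_component.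
have -> : inner x (e n) = inner (x - proj e n x) (e n).
  by rewrite innerBl inner_basis_proj ltnn subr0.
by rewrite inner_scale_conj; ring.
Qed.

Lemma proj_dist n k x : rnorm (proj e (n + k) x - proj e n x) ^+ 2 =
  \sum_(n <= i < n + k) rnorm (inner x (e i) : R[i]^o) ^+ 2.
Proof.
elim: k => [|k IH]; first by rewrite addn0 subrr rnorm0 expr0n big_geq.
rewrite addnS projS addrAC sqr_rnormD IH big_nat_recr ?leq_addr//=.
rewrite rnorm_component [rinner _ _](_ : _ = 0) ?mulr0 ?addr0//.
by rewrite /rinner innerZr innerBl !inner_basis_proj ltnn ltnNge leq_addr /= subrr mulr0.
Qed.

(** By Bessel the partial expansions converge; x minus the limit is orthogonal to
    all e_j, hence null by maximality. *)
Lemma proj_cvg x : rcvg (fun n => proj e n x) x.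
Proof.
pose b n := \sum_(0 <= k < n) rnorm (inner x (e k) : R[i]^o) ^+ 2.
have bsub m n : (m <= n)%N ->
    b n - b m = rnorm (proj e n x - proj e m x) ^+ 2.
  move=> mn; rewrite -{2}(subnKC mn) proj_dist subnKC//.
  by rewrite /b (big_cat_nat (n := m))//= addrAC subrr add0r.
have binc m n : (m <= n)%N -> b m <= b n.
  by move=> mn; rewrite -subr_ge0 bsub// sqr_ge0.
have bM n : b n <= rnorm x ^+ 2 by rewrite -subr_ge0 -bessel sqr_ge0.
have [s sP] : exists s, rcvg (fun n => proj e n x) s.
  apply: rcauchy_cvg => eps eps0.
  have eps2 : 0 < eps / 2 by rewrite divr_gt0.
  have [N NP] := nondecreasing_bounded_cauchy binc bM (exprn_gt0 2 eps2).
  have NN n : (N <= n)%N -> rnorm (proj e n x - proj e N x) <= eps / 2.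
    move=> Nn; rewrite -(ler_pXn2r (n := 2%N)) ?nnegrE ?rnorm_ge0 ?(ltW eps2)//.
    by rewrite -bsub// NP.
  exists N => m n Nm Nn; apply: le_trans (rnorm_dist (proj e N x) _ _) _.
  by rewrite (splitr eps) lerD ?NN// rnormB NN.
suff xs : x = s by rewrite [X in rcvg _ X]xs.
have [_ _ total] := eP.
apply/eqP; rewrite -subr_eq0; apply/eqP/total => j.
rewrite innerBl; apply/eqP; rewrite subr_eq0; apply/eqP.
apply: rcvg_unique _ (rcvg_innerl (e j) sP) => eps eps0.
exists j.+1 => n jn; rewrite inner_basis_proj jn subrr rnorm0.
exact: ltW.
Qed.

Lemma parseval x :
  (\sum_(0 <= k <oo) (rnorm (inner x (e k) : R[i]^o) ^+ 2)%:E = (rnorm x ^+ 2)%:E)%E.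
Proof.
apply: cvg_lim => //.
under eq_fun do rewrite sumEFin.
apply: cvg_EFin; first exact: nearW.
apply/cvgrPdist_le => eps eps0 /=.
have m0 : 0 < Num.min 1 eps by rewrite lt_min ltr01.
have [N NP] := proj_cvg x m0; exists N => // n /= Nn.
rewrite -bessel ger0_norm ?sqr_ge0//.
have := NP n Nn; rewrite le_min rnormB => /andP[h1 h2].
apply: le_trans _ h2; rewrite expr2 ler_piMl ?rnorm_ge0//.
Qed.

End parseval.
End orthonormal_bases.

(** * The trace norm *)
Section trace_norm.
Context {R : realType} {H : hilbertType R} (Hsep : separable H).
Implicit Types (A B C P S T U W X Y Z : H -> H) (x y z : H) (K L : R).

Local Notation e := (@hilbert_basis R H).

Definition hilbert_schmidt_sq S : \bar R :=
  (\sum_(0 <= n <oo) (rnorm (S (e n)) ^+ 2)%:E)%E.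

Lemma hilbert_schmidt_sq_ge0 S : (0 <= hilbert_schmidt_sq S)%E.
Proof. by apply: nneseries_ge0 => n _ _; rewrite lee_fin sqr_ge0. Qed.

(** Both sides are the double sum of |<S e_n, e_m>|^2, by Parseval. *)
Lemma hilbert_schmidt_sq_adjoint S S' :
  adjoint_pair S S' -> hilbert_schmidt_sq S = hilbert_schmidt_sq S'.
Proof.
move=> SS'; have eP := hilbert_basisP Hsep; rewrite /hilbert_schmidt_sq.
under eq_eseriesr do rewrite -(parseval eP).
under [RHS]eq_eseriesr do rewrite -(parseval eP).
rewrite nneseries_interchange; last by move=> i j; rewrite lee_fin sqr_ge0.
apply: eq_eseriesr => j _; apply: eq_eseriesr => i _; congr (_ ^+ 2)%:E.
by rewrite SS' innerC rnorm_conj.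
Qed.

Lemma hilbert_schmidt_sq_compl B S K : op_le B K ->
  (hilbert_schmidt_sq (B \o S) <= (K ^+ 2)%:E * hilbert_schmidt_sq S)%E.
Proof.
move=> [_ BK]; rewrite /hilbert_schmidt_sq -nneseriesZl; last first.
  by move=> i _; rewrite lee_fin sqr_ge0.
apply: lee_nneseries => [i _ _|i _]; first by rewrite lee_fin sqr_ge0.
rewrite -EFinM lee_fin -exprMn.
by rewrite ler_pXn2r ?nnegrE ?rnorm_ge0//= (le_trans (rnorm_ge0 _) (BK _)).
Qed.

Lemma hilbert_schmidt_sq_compr T A K : 0 <= K -> adjoint_pair T T -> op_le A K ->
  (hilbert_schmidt_sq (T \o A) <= (K ^+ 2)%:E * hilbert_schmidt_sq T)%E.
Proof.
move=> K0 TT AK; have [A' AA'] := adjoint_exists K0 AK.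
rewrite (@hilbert_schmidt_sq_adjoint _ (A' \o T)).
  by apply: hilbert_schmidt_sq_compl; exact: adjoint_pair_op_le AA' AK.
by move=> x y; rewrite /= TT AA'.
Qed.

Lemma trace_normE C T : adjoint_pair T T -> (forall x, abs_op C x = T (T x)) ->
  trace_norm C = hilbert_schmidt_sq T.
Proof.
move=> TT CT; apply: eq_eseriesr => n _; congr (_%:E).
by rewrite CT TT -/(rinner _ _) rinnerxx.
Qed.

Lemma trace_norm_ge0 C : bounded_op C -> (0 <= trace_norm C)%E.
Proof.
move=> bC; have [T [V [V' [[_ TT _ _] [CT _ _]]]]] := trace_class_factorization bC.
by rewrite (trace_normE TT CT) hilbert_schmidt_sq_ge0.
Qed.

(** With C = V T T the n-th term is <T A e_n, T V^* B e_n>, at most a_n b_n where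
    a_n = ||T A e_n|| and b_n = ||T V^* B e_n||.  The weighted inequality
    a b <= (a^2 / K + K b^2) / 2 replaces Cauchy-Schwarz for series: the sums of
    a_n^2 and b_n^2 are at most K^2 ||C||_1 and ||C||_1. *)
Lemma trace_pairing_le C A B K : bounded_op C -> 0 < K -> op_le A K -> op_le B 1 ->
  (\sum_(0 <= n <oo) (rnorm (inner (C (A (e n))) (B (e n)) : R[i]^o))%:E
     <= K%:E * trace_norm C)%E.
Proof.
move=> bC K0 AK B1.
have [T [V [V' [[_ TT V1 VV'] [CT CV _]]]]] := trace_class_factorization bC.
rewrite (trace_normE TT CT).
have V'B1 : op_le (V' \o B) 1.
  by apply: op_le_comp1 => //; exact: adjoint_pair_op_le VV' V1.
have hA := hilbert_schmidt_sq_compr (ltW K0) TT AK.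
have hB := hilbert_schmidt_sq_compr ler01 TT V'B1.
have k0 : 0 <= K / 2 by rewrite divr_ge0// ltW.
have k'0 : 0 <= K^-1 / 2 by rewrite divr_ge0// invr_ge0 ltW.
apply: (@le_trans _ _ ((K^-1 / 2)%:E * hilbert_schmidt_sq (T \o A) +
   (K / 2)%:E * hilbert_schmidt_sq (T \o (V' \o B)))%E); last first.
  have KE : K%:E = ((K^-1 / 2)%:E * (K ^+ 2)%:E + (K / 2)%:E * (1 ^+ 2)%:E)%E.
    by rewrite -!EFinM -EFinD; congr _%:E; field; rewrite gt_eqF.
  rewrite [X in (_ <= X * _)%E]KE.
  rewrite ge0_muleDl; last 2 first.
    by rewrite -EFinM lee_fin mulr_ge0 ?sqr_ge0.
    by rewrite -EFinM lee_fin mulr_ge0 ?sqr_ge0.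
  by rewrite -!muleA; apply: leeD; apply: lee_wpmul2l; rewrite ?lee_fin.
rewrite /hilbert_schmidt_sq -!nneseriesZl; last 2 first.
  by move=> i _; rewrite lee_fin sqr_ge0.
  by move=> i _; rewrite lee_fin sqr_ge0.
rewrite -nneseriesD; last 2 first.
  by move=> i _ _; rewrite -EFinM lee_fin mulr_ge0// sqr_ge0.
  by move=> i _ _; rewrite -EFinM lee_fin mulr_ge0// sqr_ge0.
apply: lee_nneseries => [i _ _|i _]; first by rewrite lee_fin rnorm_ge0.
rewrite -!EFinM -EFinD lee_fin CV VV' TT /=.
apply: le_trans (inner_CS _ _) _.
set a := rnorm _; set b := rnorm _.
rewrite -subr_ge0.
have -> : K^-1 / 2 * a ^+ 2 + K / 2 * b ^+ 2 - a * b =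
  K^-1 / 2 * (a - K * b) ^+ 2 by field; rewrite gt_eqF.
by rewrite mulr_ge0// sqr_ge0.
Qed.

(** |C| = V^* C with V the partial isometry, so <|C| e_n, e_n> = <C e_n, V e_n>. *)
Lemma trace_norm_attained C : bounded_op C -> exists2 W, op_le W 1 &
  (trace_norm C <=
     \sum_(0 <= n <oo) (rnorm (inner (C (e n)) (W (e n)) : R[i]^o))%:E)%E.
Proof.
move=> bC; have [T [V [V' [[_ TT V1 VV'] [CT _ V'C]]]]] := trace_class_factorization bC.
exists V => //; apply: lee_nneseries => [i _ _|i _].
  by rewrite CT TT -/(rinner _ _) rinnerxx lee_fin sqr_ge0.
rewrite lee_fin CT -V'C (adjoint_pair_sym VV').
exact: le_trans (ler_norm _) (Re_le_rnorm _).
Qed.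

Lemma trace_pairing_le1 C W : bounded_op C -> op_le W 1 ->
  (\sum_(0 <= n <oo) (rnorm (inner (C (e n)) (W (e n)) : R[i]^o))%:E
     <= trace_norm C)%E.
Proof.
move=> bC W1; rewrite -[leRHS]mul1e.
exact: (trace_pairing_le bC ltr01 op_le_id W1).
Qed.

(** Evaluate the pairing at the contraction that attains the norm of X - Y; unitary
    invariance below follows in the same way. *)
Lemma trace_normB X Y : bounded_op X -> bounded_op Y ->
  (trace_norm (X \- Y)%R <= trace_norm X + trace_norm Y)%E.
Proof.
move=> bX bY; have [W W1 h] := trace_norm_attained (bounded_opB bX bY).
apply: le_trans h _.
apply: le_trans (leeD (trace_pairing_le1 bX W1) (trace_pairing_le1 bY W1)).
rewrite -nneseriesD; last 2 first.
  by move=> i _ _; rewrite lee_fin rnorm_ge0.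
  by move=> i _ _; rewrite lee_fin rnorm_ge0.
apply: lee_nneseries => [i _ _|i _]; first by rewrite lee_fin rnorm_ge0.
rewrite -EFinD lee_fin /= innerBl.
by apply: le_trans (rnormD _ _) _; rewrite rnormN.
Qed.

Lemma trace_norm0 : trace_norm (fun=> 0 : H) = 0%E.
Proof.
have b0 : bounded_op (fun=> 0 : H).
  apply/bounded_opP; exists 0 => //; split=> [a x y|x]; first by rewrite scaler0 addr0.
  by rewrite rnorm0 mul0r.
apply/le_anti; rewrite trace_norm_ge0// andbT.
have [W _ h] := trace_norm_attained b0; apply: le_trans h _.
by rewrite eseries0// => i _ _; rewrite inner0l rnorm0.
Qed.

Lemma trace_normC X Y : bounded_op X -> bounded_op Y ->
  (trace_norm (X \- Y)%R <= trace_norm (Y \- X)%R)%E.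
Proof.
move=> bX bY; have [W W1 h] := trace_norm_attained (bounded_opB bX bY).
apply: le_trans h (le_trans _ (trace_pairing_le1 (bounded_opB bY bX) W1)).
apply: lee_nneseries => [i _ _|i _]; first by rewrite lee_fin rnorm_ge0.
by rewrite lee_fin /= -opprB innerNl rnormN.
Qed.

Lemma trace_norm_dist Z X Y : bounded_op X -> bounded_op Y -> bounded_op Z ->
  (trace_norm (X \- Y)%R <= trace_norm (X \- Z)%R + trace_norm (Z \- Y)%R)%E.
Proof.
move=> bX bY bZ; have bXZ := bounded_opB bX bZ; have bYZ := bounded_opB bY bZ.
rewrite (_ : X \- Y = (X \- Z) \- (Y \- Z)); last first.
  by apply/funext => x /=; rewrite opprB addrA subrK.
by apply: le_trans (trace_normB _ _) _ => //; rewrite leeD2l// trace_normC.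
Qed.

Lemma trace_norm_le_sub X Y : bounded_op X -> bounded_op Y ->
  (trace_norm X <= trace_norm (X \- Y)%R + trace_norm Y)%E.
Proof.
move=> bX bY.
have b0 : bounded_op (fun=> 0 : H).
  rewrite (_ : (fun=> 0) = X \- X); first exact: bounded_opB.
  by apply/funext => x /=; rewrite subrr.
have sub0 Z : Z \- (fun=> 0) = Z by apply/funext => x /=; rewrite subr0.
by have := trace_norm_dist bX b0 bY; rewrite !sub0.
Qed.

Lemma unitary_op_le U : unitary U ->
  [/\ bounded_op U, bounded_op (adjoint U), op_le (adjoint U) 1 &
      adjoint_pair U (adjoint U)].
Proof.
move=> [bU U'U _]; have [bU' UU'] := adjointP bU; split=> //.
apply: (adjoint_pair_op_le UU'); split=> [|x]; first by case: bU.
rewrite mul1r le_eqVlt -(eqrXn2 (n := 2%N)) ?rnorm_ge0// -!rinnerxx /rinner UU'.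
by rewrite -[adjoint U (U x)]/((_ \o _) x) U'U eqxx.
Qed.

Lemma bounded_op_conj C U : bounded_op C -> unitary U ->
  bounded_op (U \o C \o adjoint U).
Proof.
by move=> bC /unitary_op_le[bU bU' _ _]; do 2 apply: bounded_op_comp => //.
Qed.

Lemma trace_norm_conj C U : bounded_op C -> unitary U ->
  (trace_norm (U \o C \o adjoint U) <= trace_norm C)%E.
Proof.
move=> bC uU; have [bU bU' U'1 UU'] := unitary_op_le uU.
have [W W1 h] := trace_norm_attained (bounded_op_conj bC uU).
apply: le_trans h _; rewrite -[leRHS]mul1e.
apply: le_trans (trace_pairing_le bC ltr01 U'1 (op_le_comp1 U'1 W1)).
apply: lee_nneseries => [i _ _|i _]; first by rewrite lee_fin rnorm_ge0.
by rewrite lee_fin /= UU'.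
Qed.

Lemma trace_class_norm C : trace_class C ->
  exists2 c, 0 <= c & trace_norm C = c%:E.
Proof.
move=> [bC Coo]; have C0 := trace_norm_ge0 bC.
exists (fine (trace_norm C)); first exact: fine_ge0.
by rewrite fineK// ge0_fin_numE.
Qed.

Lemma trace_classB X Y : trace_class X -> trace_class Y -> trace_class (X \- Y).
Proof.
move=> tX tY; have [bX Xoo] := tX; have [bY Yoo] := tY.
split; first exact: bounded_opB.
by apply: le_lt_trans (trace_normB bX bY) _; rewrite lte_add_pinfty.
Qed.

Lemma closed_orbit_conj C U : trace_class C -> unitary U ->
  closed_orbit C (U \o C \o adjoint U).
Proof.
move=> [bC Coo] uU; split.
  split; first exact: bounded_op_conj.
  by apply: le_lt_trans (trace_norm_conj bC uU) _.
move=> eps eps0; exists (U \o C \o adjoint U); first by exists U.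
rewrite (_ : _ \- _ = fun=> 0) ?trace_norm0 ?lte_fin//.
by apply/funext => x /=; rewrite subrr.
Qed.

Lemma closed_orbit_norm C X : trace_class C -> closed_orbit C X ->
  (trace_norm X <= trace_norm C)%E.
Proof.
move=> tC [[bX _] XC]; have [bC _] := tC; apply/lee_addgt0Pr => eps eps0.
have [_ [U uU <-] h] := XC _ eps0.
apply: le_trans (trace_norm_le_sub bX (bounded_op_conj bC uU)) _.
rewrite addeC leeD//; last exact: ltW.
exact: trace_norm_conj.
Qed.

(** The unitary that brings C close to X is applied to C'. *)
Lemma closed_orbit_approx C C' X (eps : R) :
  trace_class C -> trace_class C' -> closed_orbit C X -> 0 < eps ->
  exists2 Z, closed_orbit C' Z &
    (trace_norm (X \- Z)%R <= trace_norm (C \- C')%R + eps%:E)%E.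
Proof.
move=> tC tC' [[bX _] XC] eps0; have [bC _] := tC; have [bC' _] := tC'.
have [_ [U uU <-] h] := XC _ eps0.
exists (U \o C' \o adjoint U); first exact: closed_orbit_conj.
have := trace_norm_dist bX (bounded_op_conj bC' uU) (bounded_op_conj bC uU).
move=> /le_trans; apply; rewrite addeC leeD//; last exact: ltW.
rewrite (_ : _ \- _ = U \o (C \- C') \o adjoint U).
  by apply: trace_norm_conj => //; exact: bounded_opB.
have [[linU _] _ _] := uU.
by apply/funext => x /=; rewrite (linB linU).
Qed.

End trace_norm.

(** * Hausdorff distance *)

Section hausdorff.
Context {R : realType} {V : normedModType R[i]}.

Lemma hausdorff_dist_le (r : R) (Y Z : set V) :
  (forall eps, 0 < eps -> forall y, Y y -> exists2 z, Z z & rnorm (y - z) <= r + eps) ->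
  (forall eps, 0 < eps -> forall z, Z z -> exists2 y, Y y & rnorm (z - y) <= r + eps) ->
  (hausdorff_dist Y Z <= r%:E)%E.
Proof.
have half (A B : set V) :
    (forall eps, 0 < eps -> forall y, A y -> exists2 z, B z & rnorm (y - z) <= r + eps) ->
    (ereal_sup [set dist_set y B | y in A] <= r%:E)%E.
  move=> AB; apply: ge_ereal_sup => _ [y Ay <-]; apply/lee_addgt0Pr => eps eps0.
  have [z Bz yz] := AB eps eps0 y Ay.
  apply: (@le_trans _ _ (rnorm (y - z))%:E); last by rewrite -EFinD lee_fin.
  by apply: ereal_inf_lbound; exists z.
by move=> YZ ZY; rewrite /hausdorff_dist ge_max !half.
Qed.

End hausdorff.
(** * The trace *)
Section trace.
Context {R : realType}.

Lemma rcauchy_real (u : nat -> R) :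
  (forall eps, 0 < eps -> exists N, forall m n, (N <= m)%N -> (N <= n)%N ->
     `|u m - u n| <= eps) ->
  exists l, forall eps, 0 < eps -> exists N, forall n, (N <= n)%N ->
     `|u n - l| <= eps.
Proof.
move=> uc; exists (limn u).
suff ul : u @ \oo --> limn u.
  move=> eps eps0; move/cvgrPdist_le : ul => /(_ _ eps0)[N _ NP].
  by exists N => n Nn; rewrite distrC; exact: NP.
suff : cauchy (u @ \oo) by exact: cauchy_cvg.
apply: cauchy_exP => e e0.
have e2 : 0 < e / 2 by rewrite divr_gt0.
have [N uN] := uc _ e2; exists (u N), N => // n /= Nn.
rewrite -ball_normE /ball_ /=; apply: le_lt_trans (uN _ _ (leqnn N) Nn) _.
by rewrite ltr_pdivrMr// mulr_natr mulr2n ltrDl.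
Qed.

(** Convergence of the real and imaginary parts. *)
Lemma rcauchy_complex (u : nat -> R[i]^o) : rcauchy u -> exists l, rcvg u l.
Proof.
move=> uc.
have part (f : R[i]^o -> R) : (forall z z', f (z - z') = f z - f z') ->
    (forall z, `|f z| <= rnorm z) ->
    exists l, forall eps, 0 < eps -> exists N, forall n, (N <= n)%N ->
      `|f (u n) - l| <= eps.
  move=> fB f1; apply: rcauchy_real => eps eps0; have [N NP] := uc _ eps0.
  exists N => m n Nm Nn; rewrite -fB; apply: le_trans (f1 _) _; exact: NP.
have [|//|a aP] := part (@complex.Re R); first by move=> z z'; rewrite ReD ReN.
  exact: Re_le_rnorm.
have [|//|b bP] := part (@complex.Im R); first by move=> z z'; rewrite ImD ImN.
  exact: Im_le_rnorm.
exists (a +i* b) => eps eps0; have e2 : 0 < eps / 2 by rewrite divr_gt0.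
have [N1 h1] := aP _ e2; have [N2 h2] := bP _ e2.
exists (maxn N1 N2) => n; rewrite geq_max => /andP[n1 n2].
apply: le_trans (rnorm_le_sum _) _; rewrite ReD ReN ImD ImN /=.
by rewrite (splitr eps) lerD ?h1 ?h2.
Qed.

Lemma abs_summable_cvg (c : nat -> R[i]^o) (M : R) :
  (forall n, \sum_(0 <= k < n) rnorm (c k) <= M) ->
  exists2 l, rcvg (fun n => \sum_(k < n) c k) l & rnorm l <= M.
Proof.
move=> cM.
have sum_le m n : (m <= n)%N -> rnorm (\sum_(k < n) c k - \sum_(k < m) c k) <=
    \sum_(0 <= k < n) rnorm (c k) - \sum_(0 <= k < m) rnorm (c k).
  move=> /subnKC <-; elim: (n - m)%N => [|k IH].
    by rewrite addn0 !subrr rnorm0.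
  rewrite addnS big_ord_recr big_nat_recr//= addrAC [leRHS]addrAC.
  by apply: le_trans (rnormD _ _) _; rewrite lerD2r.
have [|l ul] := @rcauchy_complex (fun n => \sum_(k < n) c k).
  move=> eps eps0.
  have e2 : 0 < eps / 2 by rewrite divr_gt0.
  have incr m n : (m <= n)%N ->
      \sum_(0 <= k < m) rnorm (c k) <= \sum_(0 <= k < n) rnorm (c k).
    by move=> mn; rewrite -subr_ge0 (le_trans (rnorm_ge0 _) (sum_le m n mn)).
  have [N NP] := nondecreasing_bounded_cauchy incr cM e2.
  exists N => m n Nm Nn; rewrite (splitr eps).
  apply: le_trans (rnorm_dist (\sum_(k < N) c k) _ _) _.
  apply: lerD; first exact: le_trans (sum_le _ _ Nm) (NP _ Nm).
  rewrite rnormB; exact: le_trans (sum_le _ _ Nn) (NP _ Nn).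
exists l => //; apply: rcvg_le ul _ => n; apply: le_trans (cM n).
by have := sum_le 0%N n isT; rewrite big_ord0 (big_geq (leqnn 0)) !subr0.
Qed.

End trace.

Section orbit_range.
Context {R : realType} {H : hilbertType R} (Hsep : separable H).
Implicit Types (A B C P S T U W X Y Z : H -> H) (x y z : H) (K L : R).

Local Notation e := (@hilbert_basis R H).
Local Notation partial_trace X :=
  (fun n => \sum_(k < n) inner (X (e k)) (e k) : R[i]^o).

Lemma trace_lim X l : rcvg (partial_trace X) l -> trace X = l.
Proof. by move=> /rcvgP Xl; apply: cvg_lim. Qed.

(** The series of the trace converges absolutely, by [trace_pairing_le] with B = id.
    A bound K > 0 is used because K may not vanish in the weighted inequality. *)
Lemma trace_comp_cvg X A K c : bounded_op X -> trace_norm X = c%:E ->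
  0 < K -> op_le A K ->
  rcvg (partial_trace (X \o A)) (trace (X \o A)) /\
  rnorm (trace (X \o A)) <= c * K.
Proof.
move=> bX Xc K0 AK.
have [n|l Xl lK] := @abs_summable_cvg R
    (fun k => inner ((X \o A) (e k)) (e k)) (c * K).
  have := trace_pairing_le Hsep bX K0 AK op_le_id.
  rewrite Xc -EFinM -lee_fin -sumEFin mulrC; apply: le_trans.
  by apply: nneseries_lim_ge => k _ _; rewrite lee_fin rnorm_ge0.
by rewrite (trace_lim Xl).
Qed.

Lemma op_le_opnorm_eps A (eps : R) : bounded_op A -> 0 < eps ->
  0 < fine (opnorm A) + eps /\ op_le A (fine (opnorm A) + eps).
Proof.
move=> bA eps0; split; first by rewrite ltr_wpDl ?fine_ge0 ?opnorm_ge0.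
by apply: op_leW (opnorm_op_le bA); rewrite lerDl ltW.
Qed.

Lemma trace_cvg X A : trace_class X -> bounded_op A ->
  rcvg (partial_trace (X \o A)) (trace (X \o A)).
Proof.
move=> tX bA; have [bX _] := tX; have [c _ Xc] := trace_class_norm tX.
have [K0 AK] := op_le_opnorm_eps bA ltr01.
by have [] := trace_comp_cvg bX Xc K0 AK.
Qed.

Lemma trace_comp_le X A c : trace_class X -> bounded_op A ->
  (trace_norm X <= c%:E)%E -> rnorm (trace (X \o A)) <= c * fine (opnorm A).
Proof.
move=> tX bA; have [bX _] := tX; have [c' c'0 Xc] := trace_class_norm tX.
rewrite Xc lee_fin => c'c; apply: (@le_trans _ _ (c' * fine (opnorm A))); last first.
  by rewrite ler_wpM2r// fine_ge0// opnorm_ge0.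
apply: ler_eps => eps eps0.
have d0 : 0 < eps / (c' + 1) by rewrite divr_gt0// ltr_wpDl.
have [K0 AK] := op_le_opnorm_eps bA d0.
have [_ h] := trace_comp_cvg bX Xc K0 AK; apply: le_trans h _.
rewrite mulrDr lerD2l mulrCA ler_piMr ?(ltW eps0)//.
by rewrite ler_pdivrMr ?mul1r ?ltr_wpDl// lerDl.
Qed.

Lemma trace_compBl X Y A : trace_class X -> trace_class Y -> bounded_op A ->
  trace (X \o A) - trace (Y \o A) = trace ((X \- Y) \o A).
Proof.
move=> tX tY bA; apply/esym/trace_lim.
have -> : partial_trace ((X \- Y) \o A) =
    (fun n => partial_trace (X \o A) n + - partial_trace (Y \o A) n).
  apply/funext => n; rewrite -sumrB; apply: eq_bigr => k _ /=.
  by rewrite innerBl.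
by apply: rcvgD; [|apply: rcvgN]; exact: trace_cvg.
Qed.

Lemma trace_compBr X A B : trace_class X -> bounded_op A -> bounded_op B ->
  trace (X \o A) - trace (X \o B) = trace (X \o (A \- B)).
Proof.
move=> tX bA bB; apply/esym/trace_lim; have [[linX _] _] := tX.
have -> : partial_trace (X \o (A \- B)) =
    (fun n => partial_trace (X \o A) n + - partial_trace (X \o B) n).
  apply/funext => n; rewrite -sumrB; apply: eq_bigr => k _ /=.
  by rewrite (linB linX) innerBl.
by apply: rcvgD; [|apply: rcvgN]; exact: trace_cvg.
Qed.

(** * Orbit ranges *)

(** Tr(XA) - Tr(ZA') = Tr(X(A - A')) + Tr((X - Z)A') for the Z of
    [closed_orbit_approx]. *)
Lemma orbit_range_approx C C' A A' c d (eps : R) (y : R[i]^o) :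
  trace_class C -> trace_class C' -> bounded_op A -> bounded_op A' ->
  (trace_norm C <= c%:E)%E -> (trace_norm (C \- C')%R <= d%:E)%E -> 0 < eps ->
  orbit_range C A y ->
  exists2 z, orbit_range C' A' z &
    rnorm (y - z) <= c * fine (opnorm (A \- A')) + d * fine (opnorm A') + eps.
Proof.
move=> tC tC' bA bA' Cc CC'd eps0 [X XC <-].
have a'0 : 0 <= fine (opnorm A') by rewrite fine_ge0 ?opnorm_ge0.
have d0 : 0 < eps / (fine (opnorm A') + 1) by rewrite divr_gt0// ltr_wpDl.
have [Z ZC' XZ] := closed_orbit_approx Hsep tC tC' XC d0.
have [tX _] := XC; have [tZ _] := ZC'.
exists (trace (Z \o A')); first by exists Z.
apply: le_trans (rnorm_dist (trace (X \o A')) _ _) _.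
rewrite trace_compBr// trace_compBl// -addrA lerD//.
  apply: trace_comp_le => //; first exact: bounded_opB.
  exact: le_trans (closed_orbit_norm Hsep tC XC) Cc.
apply: (@le_trans _ _ ((d + eps / (fine (opnorm A') + 1)) * fine (opnorm A'))).
  apply: trace_comp_le => //; first exact: trace_classB.
  by apply: le_trans XZ _; rewrite EFinD leeD2r.
rewrite mulrDl lerD2l mulrAC -mulrA ler_piMr ?(ltW eps0)//.
by rewrite ler_pdivrMr ?mul1r ?lerDl ?ltr_wpDl.
Qed.

Lemma trace_norm_diag0 C : trace_norm (C \- C) = 0%E.
Proof.
rewrite (_ : _ \- _ = fun=> 0) ?trace_norm0//.
by apply/funext => x /=; rewrite subrr.
Qed.

Lemma opnormC A B : opnorm (A \- B) = opnorm (B \- A).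
Proof.
rewrite /opnorm; congr ereal_sup; apply/seteqP.
by split=> _ [x x1 <-]; exists x => //; rewrite /= rnormB.
Qed.

Lemma opnorm_diag0 A : opnorm (A \- A) = 0%E.
Proof.
apply/le_anti; rewrite opnorm_ge0 andbT.
apply: op_le_opnorm => //; split=> [a x y|x] /=; first by rewrite !subrr scaler0 addr0.
by rewrite subrr rnorm0 mul0r.
Qed.

Lemma hausdorff_orbit_range_le C C' A A' (c c' d r : R) :
  trace_class C -> trace_class C' -> bounded_op A -> bounded_op A' ->
  (trace_norm C <= c%:E)%E -> (trace_norm C' <= c'%:E)%E ->
  (trace_norm (C \- C')%R <= d%:E)%E ->
  c * fine (opnorm (A \- A')) + d * fine (opnorm A') <= r ->
  c' * fine (opnorm (A \- A')) + d * fine (opnorm A) <= r ->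
  (hausdorff_dist (orbit_range C A) (orbit_range C' A') <= r%:E)%E.
Proof.
move=> tC tC' bA bA' Cc Cc' CC'd r1 r2.
have C'Cd : (trace_norm (C' \- C)%R <= d%:E)%E.
  by apply: le_trans _ CC'd; apply: trace_normC => //; [case: tC'|case: tC].
apply: hausdorff_dist_le => eps eps0 y yC.
  have [z zC' yz] := orbit_range_approx tC tC' bA bA' Cc CC'd eps0 yC.
  by exists z => //; apply: le_trans yz _; rewrite lerD2r.
have [z zC' yz] := orbit_range_approx tC' tC bA' bA Cc' C'Cd eps0 yC.
by exists z => //; apply: le_trans yz _; rewrite lerD2r opnormC.
Qed.

End orbit_range.

Theorem theorem3p5 (R : realType) (H : hilbertType R) (Hsep : separable H) :
  [/\ forall C A : H -> H, trace_class C -> bounded_op A ->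
        bounded_set (orbit_range C A),
      forall C A : H -> H, trace_class C -> bounded_op A ->
        forall eps : R, 0 < eps ->
        exists2 delta : R, 0 < delta &
          forall C' A' : H -> H, trace_class C' -> bounded_op A' ->
            (trace_norm (C' \- C)%R + opnorm (A' \- A)%R < delta%:E)%E ->
            (hausdorff_dist (orbit_range C' A') (orbit_range C A)
               < eps%:E)%E,
      forall C C' A : H -> H,
        trace_class C -> trace_class C' -> bounded_op A ->
        (hausdorff_dist (orbit_range C A) (orbit_range C' A)
           <= trace_norm (C \- C')%R * opnorm A)%E &
      forall C A A' : H -> H,
        trace_class C -> bounded_op A -> bounded_op A' ->
        (hausdorff_dist (orbit_range C A) (orbit_range C A')
           <= trace_norm C * opnorm (A \- A')%R)%E].
Proof.
split.
- move=> C A tC bA; have [c c0 Cc] := trace_class_norm tC.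
  exists (c * fine (opnorm A))%:C; split; first by apply/complex_realP; eexists.
  move=> M lM _ [X XC <-] /=.
  have [tX _] := XC.
  rewrite rnormE; apply: le_trans _ (ltW lM); rewrite lecR.
  by apply: trace_comp_le => //; rewrite -Cc; exact: closed_orbit_norm.
- move=> C A tC bA eps eps0; have [c c0 Cc] := trace_class_norm tC.
  have [bC _] := tC.
  pose a := fine (opnorm A).
  have a0 : 0 <= a by rewrite fine_ge0 ?opnorm_ge0.
  have ca0 : 0 < c + a + 1 by rewrite ltr_wpDl// addr_ge0.
  (* delta <= 1 keeps the norms of C' and A' below c + 1 and a + 1, and then
     (c + a + 1) delta bounds both Lipschitz estimates *)
  pose delta := Num.min 1 (eps / 2 / (c + a + 1)).
  exists delta; first by rewrite lt_min ltr01 !divr_gt0.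
  move=> C' A' tC' bA'; have [bC' _] := tC'.
  have [d d0 C'Cd] := trace_class_norm (trace_classB Hsep tC' tC).
  have [c' c'0 C'c'] := trace_class_norm tC'.
  have bA'A := bounded_opB bA' bA.
  rewrite C'Cd -opnorm_fineK// -EFinD lte_fin.
  set b := fine (opnorm (A' \- A)) => db.
  have b0 : 0 <= b by rewrite fine_ge0 ?opnorm_ge0.
  have delta1 : delta <= 1 by rewrite /delta ge_min lexx.
  have delta_eps : (c + a + 1) * delta <= eps / 2.
    by rewrite mulrC -ler_pdivlMr// /delta ge_min lexx orbT.
  have c'_le : c' <= c + 1.
    have := trace_norm_le_sub Hsep bC' bC; rewrite C'c' C'Cd Cc -EFinD lee_fin; lra.
  have a'_le : fine (opnorm A') <= a + 1.
    apply: (@le_trans _ _ (b + a)); last by lra.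
    rewrite -lee_fin opnorm_fineK//; apply: op_le_opnorm; first exact: addr_ge0.
    rewrite (_ : A' = (A' \- A) \+ A); last by apply/funext => x /=; rewrite subrK.
    exact: op_leD (opnorm_op_le bA'A) (opnorm_op_le bA).
  apply: (@le_lt_trans _ _ (eps / 2)%:E); last first.
    by rewrite lte_fin ltr_pdivrMr// mulr_natr mulr2n ltrDl.
  apply: (@hausdorff_orbit_range_le _ _ Hsep _ _ _ _ c' c d) => //.
  + by rewrite C'c'.
  + by rewrite Cc.
  + by rewrite C'Cd.
  + rewrite -/a -/b; nra.
  + rewrite -/b; have := fine_ge0 (opnorm_ge0 A'); nra.
- move=> C C' A tC tC' bA.
  have [d d0 CC'd] := trace_class_norm (trace_classB Hsep tC tC').
  have [c _ Cc] := trace_class_norm tC; have [c' _ Cc'] := trace_class_norm tC'.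
  rewrite CC'd -opnorm_fineK// -EFinM.
  apply: (@hausdorff_orbit_range_le _ _ Hsep _ _ _ _ c c' d) => //.
  + by rewrite Cc.
  + by rewrite Cc'.
  + by rewrite CC'd.
  + by rewrite opnorm_diag0 mulr0 add0r.
  + by rewrite opnorm_diag0 mulr0 add0r.
- move=> C A A' tC bA bA'; have [c _ Cc] := trace_class_norm tC.
  rewrite Cc -opnorm_fineK; last exact: bounded_opB.
  rewrite -EFinM.
  apply: (@hausdorff_orbit_range_le _ _ Hsep _ _ _ _ c c 0) => //.
  + by rewrite Cc.
  + by rewrite Cc.
  + by rewrite trace_norm_diag0.
  + by rewrite mul0r addr0.
  + by rewrite mul0r addr0.
Qed.
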